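(* Let $P$ be a regular $l_1$-property. Then $P^{\mathrm{co}}$ is also a regular $l_1$-property.
   Context: Scalars are real. Properties of Banach spaces are identified with classes of Banach spaces. $S(X)$ denotes the unit sphere of $X$. For a set $\Gamma$, $l_1(\Gamma)$ is the usual space of absolutely summable real functions on $\Gamma$, and for a Banach space $X$, $l_\infty(\Gamma,X)$ is the space of bounded functions $x:\Gamma\to X$ with the sup-norm. Each $a\in S(l_1(\Gamma))$ is identified with the linear operator $a:l_\infty(\Gamma,X)\to X$, $a(x)=\sum_{\gamma\in\Gamma}a(\gamma)x(\gamma)$. Here $\mathrm{sign}\,t\in\{0,1,-1\}$ for real $t$. Index. For $A\subset S(l_1(\Gamma))$ and a Banach space $X$, the index $h(X,A)$ of $A$ in $X$ is the supremum of those $\delta$ for which there exists $x\in S(l_\infty(\Gamma,X))$ with $\inf_{a\in A}\|a(x)\|\ge\delta$. Regular $l_1$-property. A class $P$ of Banach spaces is a regular $l_1$-property if there exist a real number $\delta>0$, a set $\Gamma$ and a subset $A\subset S(l_1(\Gamma))$ satisfying: 1. $A$ consists of finitely non-zero vectors. 2. If $a_0\in A$, then $A$ contains all vectors $a\in S(l_1(\Gamma))$ for which $\mathrm{sign}\,a_0(\gamma)=\mathrm{sign}\,a(\gamma)$ for all $\gamma\in\Gamma$. 3. For a Banach space $X$ the following are equivalent: (a) $X\notin P$; (b) $h(X,A)>0$; (c) $h(X,A)\ge\delta$. Coclass. For a class $P$ of Banach spaces, the coclass $P^{\mathrm{co}}$ is the class of all Banach spaces $X$ for which the quotient space $X^{**}/X$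 is in $P$ (where $X$ is canonically embedded in its bidual $X^{**}$). *)

(* Defs.v *)
From HB Require Import structures.
From mathcomp Require Import all_boot all_order all_algebra.
From mathcomp Require Import all_classical all_reals all_analysis.
From mathcomp.analysis.showcase Require summability.
From mathcomp Require Import finmap ring lra.

Set Implicit Arguments.
Unset Strict Implicit.
Unset Printing Implicit Defensive.

Import Order.TTheory GRing.Theory Num.Theory.
Import numFieldNormedType.Exports.

Local Open Scope classical_set_scope.
Local Open Scope ring_scope.

(* Real Banach spaces are the objects of [completeNormedModType R] with       *)
(* [R : realType].  The library has neither the topological dual nor normed   *)
(* quotients; both are built here, so that the bidual quotient X** / X is     *)
(* again a [completeNormedModType R]:                                         *)
(*     dual X              == continuous linear functionals, operator norm    *)
(*     quotient_space S    == V / S for a closed subspace S, quotient norm    *)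
(*     canonical_embedding == evaluation map X -> X**                         *)
(*     bidual_quotient X   == X** / X                                         *)
(* The Hahn-Banach theorem, in the form [norming_functional], makes the       *)
(* canonical embedding isometric, hence its image closed.                     *)

Section norming_functional.
Context {R : realType} {X : normedModType R}.
Implicit Types (p q : X -> R) (x y z : X) (t s : R).

Definition sublinear p :=
  (forall x y, p (x + y) <= p x + p y) /\
  (forall t x, 0 < t -> p (t *: x) <= t * p x).

Lemma sublinear0 p : sublinear p -> p 0 = 0.
Proof.
move=> [pD pZ]; have := pD 0 0; have := pZ 2^-1 0.
rewrite scaler0 addr0 invr_gt0 => /(_ (ltr0Sn _ 1)); lra.
Qed.

Lemma sublinearZ p t x : sublinear p -> 0 < t -> p (t *: x) = t * p x.
Proof.
move=> [pD pZ] t0; apply/eqP; rewrite eq_le pZ//=.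
have := pZ t^-1 (t *: x); rewrite scalerA mulVf ?gt_eqF// scale1r invr_gt0.
by move=> /(_ t0); rewrite mulrC ler_pdivlMr// mulrC.
Qed.

Lemma sublinearN p x : sublinear p -> - p (- x) <= p x.
Proof.
by move=> sp; have := sp.1 x (- x); rewrite subrr sublinear0// lerNl; lra.
Qed.

(* the largest sublinear functional below p that is linear along the ray of a *)
Let descent p a x := inf [set p (x + t *: a) - t * p a | t in [set t | 0 <= t]].

Let descent_lb p a x :
  sublinear p -> lbound [set p (x + t *: a) - t * p a | t in [set t | 0 <= t]] (- p (- x)).
Proof.
move=> sp _ [t /= t0 <-]; have := sp.1 (x + t *: a) (- x).
rewrite [x + _]addrC addrK; suff -> : p (t *: a) = t * p a by lra.
move: t0; rewrite le_eqVlt => /predU1P[<-|t0]; last exact: sublinearZ.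
by rewrite scale0r mul0r sublinear0.
Qed.

Let descent_le p a x t :
  sublinear p -> 0 <= t -> descent p a x <= p (x + t *: a) - t * p a.
Proof.
move=> sp t0; apply: ge_inf; last by exists t.
by exists (- p (- x)); exact: descent_lb.
Qed.

Let descent_ge p a x c : (forall t, 0 <= t -> c <= p (x + t *: a) - t * p a) ->
  c <= descent p a x.
Proof.
move=> h; apply: lb_le_inf; first by exists (p (x + 0 *: a) - 0 * p a); exists 0 => /=.
by move=> _ [t /= t0 <-]; exact: h.
Qed.

Let descent_sublinear p a : sublinear p -> sublinear (descent p a).
Proof.
move=> sp; split=> [x y|t x t0].
  rewrite -lerBlDr; apply: descent_ge => t t0.
  rewrite lerBlDl -lerBlDr; apply: descent_ge => s s0.
  have := descent_le a (x + y) sp (addr_ge0 t0 s0).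
  have := sp.1 (x + t *: a) (y + s *: a).
  rewrite addrACA -scalerDl; lra.
rewrite mulrC -ler_pdivrMr//; apply: descent_ge => s s0.
rewrite ler_pdivrMr//; apply: (le_trans (descent_le _ _ sp (mulr_ge0 (ltW t0) s0))).
rewrite -scalerA -scalerDr (sublinearZ _ sp)//; lra.
Qed.

Let minimal_linear q : sublinear q ->
  (forall p, sublinear p -> (forall x, p x <= q x) -> p = q) ->
  forall t x y, q (t *: x + y) = t * q x + q y.
Proof.
move=> sq qmin.
have qN x : q (- x) = - q x.
  apply/eqP; rewrite eq_le; apply/andP; split; last first.
    by have := sublinearN x sq; lra.
  have <- : descent q x = q.
    apply: qmin => [|y]; first exact: descent_sublinear.
    by have := descent_le x y sq (lexx 0); rewrite scale0r mul0r subr0 addr0.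
  have := descent_le x (- x) sq ler01.
  rewrite scale1r mul1r addNr sublinear0// sub0r => /le_trans; apply.
  rewrite lerN2; have := descent_le x x sq (lexx 0).
  by rewrite scale0r mul0r subr0 addr0.
have qD x y : q (x + y) = q x + q y.
  apply/eqP; rewrite eq_le sq.1/=; have := sq.1 (x + y) (- y).
  by rewrite addrK qN; lra.
move=> t x y; rewrite qD; congr (_ + _).
have [t0|t0|->] := ltgtP t 0; last by rewrite scale0r mul0r sublinear0.
  by rewrite -[t *: x]opprK -scaleNr qN sublinearZ ?oppr_gt0//; lra.
by rewrite sublinearZ.
Qed.

Let minorant p0 : sublinear p0 -> exists q, [/\ sublinear q,
  (forall x, q x <= p0 x) &
  (forall p, sublinear p -> (forall x, p x <= q x) -> p = q)].
Proof.
move=> sp0.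
pose T := {p : X -> R | sublinear p /\ forall x, p x <= p0 x}.
pose rT (p q : T) := `[< forall x, sval q x <= sval p x >].
have [| | | |q qmax] := @Zorn T rT.
- by move=> p; apply/asboolP.
- by move=> r s t /asboolP rs /asboolP st; apply/asboolP => x; exact: le_trans (rs x).
- move=> [s Ps] [t Pt] /asboolP/= st /asboolP/= ts; apply: eq_exist.
  by apply/funext => x; apply/eqP; rewrite eq_le st ts.
- move=> A totA; have [[a Aa]|A0] := pselect (exists a, A a); last first.
    have P : sublinear p0 /\ forall x, p0 x <= p0 x by split.
    by exists (exist _ p0 P) => s As; exfalso; apply: A0; exists s.
  pose S x := [set sval r x | r in A].
  have Slb x : lbound (S x) (- p0 (- x)).
    move=> _ [r Ar <-]; have := sublinearN x (svalP r).1.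
    by have := (svalP r).2 (- x); lra.
  pose m x := inf (S x).
  have mle r x : A r -> m x <= sval r x.
    move=> Ar; apply: ge_inf; last by exists r.
    by exists (- p0 (- x)); exact: Slb.
  have mge x c : (forall r, A r -> c <= sval r x) -> c <= m x.
    move=> h; apply: lb_le_inf; first by exists (sval a x); exists a.
    by move=> _ [r Ar <-]; exact: h.
  have P : sublinear m /\ forall x, m x <= p0 x.
    split; last by move=> x; exact: le_trans (mle _ _ Aa) ((svalP a).2 x).
    split=> [x y|t x t0].
      rewrite -lerBlDr; apply: (mge _ _) => r Ar.
      rewrite lerBlDl -lerBlDr; apply: mge => s As; rewrite lerBlDr.
      have [/asboolP rs|/asboolP sr] := totA _ _ Ar As.
        apply: (le_trans (mle s _ As)); apply: (le_trans ((svalP s).1.1 _ _)).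
        by rewrite addrC lerD.
      apply: (le_trans (mle r _ Ar)); apply: (le_trans ((svalP r).1.1 _ _)).
      by rewrite addrC lerD.
    rewrite mulrC -ler_pdivrMr//; apply: mge => r Ar.
    rewrite ler_pdivrMr//; apply: (le_trans (mle _ _ Ar)).
    by rewrite mulrC; exact: (svalP r).1.2.
  by exists (exist _ m P) => s As; apply/asboolP => x /=; exact: mle.
exists (sval q); split; [exact: (svalP q).1|exact: (svalP q).2|].
move=> p sp pq.
have P : sublinear p /\ forall x, p x <= p0 x.
  by split=> // x; exact: le_trans (pq x) ((svalP q).2 x).
by have /(congr1 sval) := qmax (exist _ p P) (asboolT pq).
Qed.

Lemma norming_functional a : exists f : X -> R,
  [/\ forall t x y, f (t *: x + y) = t * f x + f y,
      forall x, `|f x| <= `|x| & f a = `|a|].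
Proof.
pose n x := `|x|.
have sn : sublinear n.
  by split=> [x y|t x t0]; rewrite /n ?ler_normD// normrZ gtr0_norm.
have [f [sf fle fmin]] := minorant (descent_sublinear a sn).
have fL := minimal_linear sf fmin.
have fn x : f x <= `|x|.
  apply: (le_trans (fle x)); have := descent_le a x sn (lexx 0).
  by rewrite scale0r mul0r subr0 addr0.
have fN x : f (- x) = - f x.
  by have := fL (-1) x 0; rewrite addr0 scaleN1r mulN1r (sublinear0 sf) addr0.
exists f; split=> // [x|].
  by rewrite ler_norml fn andbT lerNl -fN -normrN.
apply/eqP; rewrite eq_le fn/= -lerN2 -fN; apply: (le_trans (fle _)).
have := descent_le a (- a) sn ler01.
by rewrite scale1r mul1r addNr /n normr0 sub0r.
Qed.

End norming_functional.

Definition continuous_functional {R : realType} {X : normedModType R} :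
  {pred X -> R^o} := fun f => `[< linear f /\ continuous f >].

Section dual.
Context {R : realType} {X : normedModType R}.

Lemma continuous_functionalP (f : X -> R^o) :
  reflect (linear f /\ exists M : R, forall x, `|f x| <= M * `|x|)
          (f \in continuous_functional).
Proof.
apply: (iffP (asboolP _)) => [[fL fC]|[fL [M fM]]]; split => //.
  pose g := GRing.isLinear.Build R X R^o *:%R f fL.
  pose h : {linear X -> R^o} := HB.pack f g.
  have /linear_bounded_continuous/linear_boundedP : continuous h by [].
  by move=> /pinfty_ex_gt0[M _ hM]; exists M.
pose g := GRing.isLinear.Build R X R^o *:%R f fL.
pose h : {linear X -> R^o} := HB.pack f g.
apply: (@bounded_linear_continuous _ _ _ h); apply/linear_boundedP.
near=> r => x; apply: (le_trans (fM x)); apply: ler_wpM2r; first exact: normr_ge0.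
by near: r; apply: nbhs_pinfty_ge; exact: num_real.
Unshelve. all: by end_near. Qed.

Lemma continuous_functional_submod : submod_closed (@continuous_functional R X).
Proof.
split=> [|t f g /continuous_functionalP[fL [M fM]] /continuous_functionalP[gL [N gN]]].
  apply/continuous_functionalP; split.
    by move=> t x y; rewrite -[LHS]/(0 : R^o) -[RHS]/(t *: (0 : R^o) + 0) scaler0 addr0.
  by exists 0 => x; rewrite -[X in `|X|]/(0 : R^o) normr0 mul0r.
apply/continuous_functionalP; split.
  by move=> s x y; rewrite !fctE fL gL /GRing.scale/=; ring.
exists (`|t| * M + N) => x; rewrite !fctE (le_trans (ler_normD _ _))//.
by rewrite mulrDl lerD// normrM -mulrA ler_wpM2l.
Qed.

HB.instance Definition _ := GRing.isSubmodClosed.Build R (X -> R^o)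
  (@continuous_functional R X) continuous_functional_submod.
End dual.

Record dual (R : realType) (X : normedModType R) := Dual {
  dual_val :> X -> R^o ;
  _ : dual_val \in continuous_functional }.

HB.instance Definition _ (R : realType) (X : normedModType R) :=
  [isSub for @dual_val R X].
HB.instance Definition _ (R : realType) (X : normedModType R) :=
  [Choice of dual X by <:].
HB.instance Definition _ (R : realType) (X : normedModType R) :=
  [SubChoice_isSubLmodule of dual X by <:].

Section dual_norm.
Context {R : realType} {X : normedModType R}.
Implicit Types (f g : dual X) (x y : X).

Definition dual_norm f : R := sup [set `|f x| | x in [set x | `|x| <= 1]].

Lemma dualP f t x y : f (t *: x + y) = t * f x + f y.
Proof. by have /continuous_functionalP[fL _] := valP f; exact: fL. Qed.

Lemma dual0 f : f 0 = 0.
Proof. by have := dualP f (-1) 0 0; rewrite scaler0 addr0; lra. Qed.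

Lemma dualZ f t x : f (t *: x) = t * f x.
Proof. by have := dualP f t x 0; rewrite dual0 !addr0. Qed.

Lemma dual_ext f g : f =1 g -> f = g.
Proof. by move=> fg; apply/val_inj/funext. Qed.

Let ball_neq0 f : [set `|f x| | x in [set x | `|x| <= 1]] !=set0.
Proof. by exists `|f 0|; exists 0; rewrite //= normr0. Qed.

Let ball_ub f : has_ubound [set `|f x| | x in [set x | `|x| <= 1]].
Proof.
have /continuous_functionalP[_ [M fM]] := valP f.
exists `|M| => _ [x /= x1 <-]; apply: (le_trans (fM x)).
by rewrite (le_trans (ler_norm _))// normrM normr_id ler_piMr.
Qed.

Lemma dual_norm_ge0 f : 0 <= dual_norm f.
Proof.
apply: (@le_trans _ _ `|f 0|); first exact: normr_ge0.
by apply: ub_le_sup; [exact: ball_ub|exists 0; rewrite //= normr0].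
Qed.

Lemma dual_norm_ub f x : `|f x| <= dual_norm f * `|x|.
Proof.
have [->|x0] := eqVneq x 0; first by rewrite dual0 !normr0 mulr0.
have nx0 : 0 < `|x| by rewrite normr_gt0.
rewrite -ler_pdivrMr//; apply: ub_le_sup; first exact: ball_ub.
exists (`|x|^-1 *: x); first by rewrite /= normfZV.
by rewrite dualZ normrM normfV normr_id mulrC.
Qed.

Lemma dual_norm_le f M : 0 <= M -> (forall x, `|f x| <= M * `|x|) ->
  dual_norm f <= M.
Proof.
move=> M0 fM; apply: ge_sup; first exact: ball_neq0.
by move=> _ [x /= x1 <-]; rewrite (le_trans (fM x))// ler_piMr.
Qed.

Let normD f g : dual_norm (f + g) <= dual_norm f + dual_norm g.
Proof.
apply: dual_norm_le => [|x]; first by rewrite addr_ge0 ?dual_norm_ge0.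
rewrite mulrDl; apply: (le_trans (ler_normD _ _)).
by rewrite lerD// dual_norm_ub.
Qed.

Let normZ_le t f : dual_norm (t *: f) <= `|t| * dual_norm f.
Proof.
apply: dual_norm_le => [|x]; first by rewrite mulr_ge0 ?dual_norm_ge0.
by rewrite [X in `|X|]/(_ * _) normrM -mulrA ler_wpM2l ?dual_norm_ub.
Qed.

Let normZ t f : dual_norm (t *: f) = `|t| * dual_norm f.
Proof.
apply/eqP; rewrite eq_le normZ_le/=.
have [->|t0] := eqVneq t 0; first by rewrite normr0 mul0r dual_norm_ge0.
have := normZ_le t^-1 (t *: f).
by rewrite scalerA mulVf// scale1r normfV ler_pdivlMl ?normr_gt0.
Qed.

Let norm_eq0 f : dual_norm f = 0 -> f = 0.
Proof.
move=> f0; apply: dual_ext => x; apply/eqP; rewrite -normr_le0.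
by rewrite (le_trans (dual_norm_ub _ _))// f0 mul0r.
Qed.

HB.instance Definition _ := Lmodule_isNormed.Build R (dual X) normD normZ norm_eq0.

Lemma dual_normE f : `|f| = dual_norm f. Proof. by []. Qed.

Lemma dual_complete (F : set_system (dual X)) :
  ProperFilter F -> cauchy F -> cvg F.
Proof.
move=> FF /cauchyP Fc.
have cv x : cvg ((fun g : dual X => g x : R^o) @ F).
  apply: cauchy_cvg; apply: cauchy_exP => e e0.
  have d0 : 0 < e / (`|x| + 1) by rewrite divr_gt0// ltr_wpDl.
  have [f0 Ff0] := Fc _ d0; exists (f0 x).
  suff : F [set g : dual X | ball (f0 x : R^o) e (g x)] by [].
  apply: filterS Ff0 => g; rewrite -!ball_normE/= => f0g.
  have {}f0g : dual_norm (f0 - g) < e / (`|x| + 1) by [].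
  rewrite -[f0 x - g x]/((f0 - g) x) (le_lt_trans (dual_norm_ub _ _))//.
  have /le_lt_trans : dual_norm (f0 - g) * `|x| <= dual_norm (f0 - g) * (`|x| + 1).
    by rewrite ler_wpM2l ?dual_norm_ge0// lerDl.
  by apply; rewrite -ltr_pdivlMr// ltr_wpDl.
pose f x : R^o := lim ((fun g : dual X => g x : R^o) @ F).
have fP x (e : R) : 0 < e -> F [set g : dual X | `|f x - g x| <= e].
  by move=> e0; have /cvgrPdist_le := cv x; apply.
have fN (f0 : dual X) (e : R) : F (ball f0 e) -> forall x, `|f x - f0 x| <= e * `|x|.
  move=> Ff0 x; apply/ler_addgt0Pr => d d0.
  have [g [/= fg f0g]] := filter_ex (filterI (fP x _ d0) Ff0).
  move: f0g; rewrite -ball_normE/= => f0g.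
  have {}f0g : dual_norm (f0 - g) < e by [].
  have -> : f x - f0 x = (f x - g x) - (f0 - g) x.
    by rewrite -[(f0 - g) x]/(f0 x - g x); ring.
  rewrite (le_trans (ler_normB _ _))// addrC lerD//.
  by rewrite (le_trans (dual_norm_ub _ _))// ler_wpM2r// ltW.
have fL : linear f.
  move=> t x y; apply: cvg_lim => //.
  rewrite [X in X @ _ --> _](_ : _ = (fun g : dual X => t *: (g x : R^o) + g y)).
    by apply: cvgD; [apply: cvgZr; exact: cv|exact: cv].
  by apply/funext => g; rewrite dualP.
have fC : (f : X -> R^o) \in continuous_functional.
  apply/continuous_functionalP; split=> //.
  have [f0 /fN f0f] := Fc _ ltr01; exists (1 + dual_norm f0) => x.
  rewrite -[f x](subrK (f0 x)) (le_trans (ler_normD _ _))// mulrDl.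
  by rewrite lerD// dual_norm_ub.
apply/cvg_ex; exists (Dual fC); apply/cvgrPdist_le => e e0.
have e20 : 0 < e / 2 by rewrite divr_gt0.
have [f0 Ff0] := Fc _ e20; have f0f := fN _ _ Ff0.
apply: filterS Ff0 => g; rewrite -ball_normE/= => f0g.
rewrite -(subrK f0 (Dual fC)) -addrA (le_trans (ler_normD _ _))// (splitr e).
rewrite lerD ?(ltW f0g)//.
by apply: dual_norm_le; [exact: ltW|exact: f0f].
Qed.

HB.instance Definition _ := Uniform_isComplete.Build (dual X) dual_complete.

End dual_norm.

Record closedSubspace (R : realType) (V : normedModType R) := ClosedSubspace {
  subspace_pred :> {pred V} ;
  subspace_submod : submod_closed subspace_pred ;
  subspace_closed : closed [set x | x \in subspace_pred] }.

HB.instance Definition _ (R : realType) (V : normedModType R)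
  (S : closedSubspace V) :=
  GRing.isSubmodClosed.Build R V (subspace_pred S) (subspace_submod S).

Definition quotient_space (R : realType) (V : normedModType R)
  (S : closedSubspace V) := Quotient.quot (subspace_pred S).

HB.instance Definition _ (R : realType) (V : normedModType R)
  (S : closedSubspace V) := GRing.Zmodule.on (quotient_space S).

Section quotient_space.
Context {R : realType} {V : normedModType R} (S : closedSubspace V).
Local Notation Q := (quotient_space S).
Implicit Types (x y : V) (p q : Q) (t : R).

Definition quotient_map (x : V) : Q := \pi_(Quotient.quot (subspace_pred S))%qT x.

Definition quotient_scale t q : Q := quotient_map (t *: (repr q : V)).

Definition quotient_norm q : R := inf [set `|x| | x in [set x | quotient_map x = q]].

Lemma quotient_map_eq x y : quotient_map x = quotient_map y <-> x - y \in S.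
Proof.
rewrite (Quotient.idealrBE (subspace_pred S)) /quotient_map.
by split=> [->//|/eqP].
Qed.

Lemma quotient_map_surj q : quotient_map (repr q) = q.
Proof. exact: reprK. Qed.

Lemma quotient_mapD x y :
  quotient_map (x + y) = quotient_map x + quotient_map y.
Proof. by rewrite /quotient_map -[LHS]/(\pi_(Quotient.quot (subspace_pred S))%qT (x + y)) raddfD. Qed.

Lemma quotient_mapB x y :
  quotient_map (x - y) = quotient_map x - quotient_map y.
Proof. by rewrite /quotient_map -[LHS]/(\pi_(Quotient.quot (subspace_pred S))%qT (x - y)) raddfB. Qed.

Lemma quotient_map0 : quotient_map 0 = 0.
Proof. by have := quotient_mapB 0 0; rewrite !subrr. Qed.

Lemma quotient_map_scale t x :
  quotient_map (t *: x) = quotient_scale t (quotient_map x).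
Proof.
apply/quotient_map_eq; rewrite -scalerBr rpredZ//.
by apply/quotient_map_eq; rewrite quotient_map_surj.
Qed.

Let scalerqA t s q : quotient_scale t (quotient_scale s q) = quotient_scale (t * s) q.
Proof. by rewrite -[q]quotient_map_surj -!quotient_map_scale scalerA. Qed.

Let scale1q : left_id 1 quotient_scale.
Proof. by move=> q; rewrite -[q in LHS]quotient_map_surj -quotient_map_scale scale1r quotient_map_surj. Qed.

Let scalerqDr : right_distributive quotient_scale +%R.
Proof.
move=> t p q; rewrite -[p]quotient_map_surj -[q]quotient_map_surj.
by rewrite -quotient_mapD -!quotient_map_scale scalerDr quotient_mapD.
Qed.

Let scalerqDl q : {morph quotient_scale^~ q : t s / t + s}.
Proof.
move=> t s; rewrite -[q]quotient_map_surj -!quotient_map_scale.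
by rewrite scalerDl quotient_mapD.
Qed.

HB.instance Definition _ := GRing.Zmodule_isLmodule.Build R Q
  scalerqA scale1q scalerqDr scalerqDl.

Lemma quotient_mapZ t x : quotient_map (t *: x) = t *: quotient_map x.
Proof. exact: quotient_map_scale. Qed.

Lemma quotient_norm_le x : quotient_norm (quotient_map x) <= `|x|.
Proof. by apply: ge_inf; [exists 0 => _ [y _ <-]|exists x]. Qed.

Lemma quotient_norm_lift q (e : R) : 0 < e ->
  exists2 x, quotient_map x = q & `|x| < quotient_norm q + e.
Proof.
move=> e0; have [|_ [x xq <-] xe] := @inf_adherent _ [set `|x| | x in [set x | quotient_map x = q]] _ e0.
  split; last by exists 0 => _ [y _ <-].
  by exists `|repr q|, (repr q) => //; exact: quotient_map_surj.
by exists x.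
Qed.

Lemma quotient_norm_ge0 q : 0 <= quotient_norm q.
Proof.
apply: lb_le_inf; last by move=> _ [y _ <-].
by exists `|repr q|, (repr q) => //; exact: quotient_map_surj.
Qed.

Let normD p q : quotient_norm (p + q) <= quotient_norm p + quotient_norm q.
Proof.
apply/ler_addgt0Pr => e e0.
have e20 : 0 < e / 2 by rewrite divr_gt0.
have [x <- xe] := quotient_norm_lift p e20.
have [y <- ye] := quotient_norm_lift q e20.
rewrite -quotient_mapD (le_trans (quotient_norm_le _))//.
by rewrite (le_trans (ler_normD _ _))//; lra.
Qed.

Let normZ_le t q : quotient_norm (t *: q) <= `|t| * quotient_norm q.
Proof.
apply/ler_addgt0Pr => e e0.
have d0 : 0 < e / (`|t| + 1) by rewrite divr_gt0// ltr_wpDl.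
have [x <- xe] := quotient_norm_lift q d0.
rewrite -quotient_mapZ (le_trans (quotient_norm_le _))// normrZ.
rewrite (le_trans (ler_wpM2l (normr_ge0 t) (ltW xe)))// mulrDr lerD2l.
rewrite mulrA ler_pdivrMr ?ltr_wpDl// mulrC ler_wpM2l ?(ltW e0)//.
by rewrite lerDl ler01.
Qed.

Let normZ t q : quotient_norm (t *: q) = `|t| * quotient_norm q.
Proof.
apply/eqP; rewrite eq_le normZ_le/=.
have [->|t0] := eqVneq t 0; first by rewrite normr0 mul0r quotient_norm_ge0.
have := normZ_le t^-1 (t *: q).
by rewrite scalerA mulVf// scale1r normfV ler_pdivlMl ?normr_gt0.
Qed.

Let norm_eq0 q : quotient_norm q = 0 -> q = 0.
Proof.
move=> q0; rewrite -[q]quotient_map_surj -quotient_map0.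
apply/quotient_map_eq; rewrite subr0.
apply: (@subspace_closed _ _ S); move=> B /nbhs_ballP[e /= e0 eB].
have [y yq] := quotient_norm_lift q e0; rewrite q0 add0r => ye.
exists (repr q - y); split.
  by apply/quotient_map_eq; rewrite quotient_map_surj.
by apply: eB; rewrite -ball_normE/= opprB addrC subrK.
Qed.

HB.instance Definition _ := Lmodule_isNormed.Build R Q normD normZ norm_eq0.

End quotient_space.

Section quotient_complete.
Context {R : realType} {V : completeNormedModType R} (S : closedSubspace V).
Local Notation Q := (quotient_space S).

Lemma quotient_complete (F : set_system Q) :
  ProperFilter F -> cauchy F -> cvg F.
Proof.
move=> FF /cauchyP Fc.
pose r n : R := 2^-1 ^+ n.
have r0 n : 0 < r n by rewrite exprn_gt0// invr_gt0.
have [u Fu] := choice (fun n => Fc (r n) (r0 n)).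
have uu n : `|u n.+1 - u n| < 2 * r n.
  have [p [pn pn1]] := filter_ex (filterI (Fu n) (Fu n.+1)).
  move: pn pn1; rewrite -!ball_normE/= => pn pn1.
  have -> : u n.+1 - u n = (u n.+1 - p) - (u n - p) by rewrite opprB addrA subrK.
  rewrite (le_lt_trans (ler_normB _ _))//.
  have rS : r n.+1 = 2^-1 * r n by rewrite /r exprS.
  by move: pn1; rewrite rS; have := r0 n; lra.
have /choice[w wu] : forall n, exists x,
    quotient_map S x = u n.+1 - u n /\ `|x| <= 3 * r n.
  move=> n; have [x xu xr] := quotient_norm_lift (u n.+1 - u n) (r0 n).
  exists x; split=> //; apply: ltW; apply: (lt_trans xr).
  by have := uu n; rewrite -[ `|_|]/(quotient_norm _); lra.
have /cvg_ex[l wl] : cvgn (series w).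
  apply: normed_cvg.
  apply: (series_le_cvg _ _ _ (@is_cvg_geometric_series _ 3 2^-1 _)) => [n|n|n|].
  - exact: normr_ge0.
  - by rewrite /geometric/= mulr_ge0// exprn_ge0.
  - exact: (wu n).2.
  - by rewrite ger0_norm ?invf_lt1 ?ltr1n.
pose v n := repr (u 0) + series w n.
have vu n : quotient_map S (v n) = u n.
  elim: n => [|n ih].
    by rewrite /v /series/= big_geq// addr0 quotient_map_surj.
  have -> : v n.+1 = v n + w n by rewrite /v seriesSr addrA.
  by rewrite quotient_mapD ih (wu n).1 addrC subrK.
apply/cvg_ex; exists (quotient_map S (repr (u 0) + l)); apply/cvgrPdist_le => e e0.
have e20 : 0 < e / 2 by rewrite divr_gt0.
have r2 : r n @[n --> \oo] --> 0.
  by apply: cvg_expr; rewrite ger0_norm ?invf_lt1 ?ltr1n.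
have h1 : \forall n \near \oo, `|l - series w n| <= e / 2.
  by move/cvgrPdist_le : wl; exact.
have h2 : \forall n \near \oo, r n <= e / 2.
  move/cvgrPdist_le : r2 => /(_ _ e20); apply: filterS => n.
  by rewrite sub0r normrN gtr0_norm.
have [n [/= ln rn]] := filter_ex (filterI h1 h2).
apply: filterS (Fu n) => p; rewrite -ball_normE/= => up.
rewrite -(subrK (u n) (quotient_map S _)) -addrA (le_trans (ler_normD _ _))//.
rewrite (splitr e) lerD//; last by rewrite (le_trans (ltW up)).
rewrite -(vu n) -quotient_mapB /v opprD addrACA subrr add0r.
exact: le_trans (quotient_norm_le _ _) ln.
Qed.

HB.instance Definition _ := Uniform_isComplete.Build Q quotient_complete.

End quotient_complete.

Section canonical_embedding.
Context {R : realType} {X : normedModType R}.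
Implicit Types (x y : X) (f : dual X).

Let eval_continuous x : ((fun f : dual X => f x) : dual X -> R^o) \in continuous_functional.
Proof.
apply/continuous_functionalP; split; first by [].
by exists `|x| => f; rewrite mulrC; exact: dual_norm_ub.
Qed.

Definition canonical_embedding x : dual (dual X) := Dual (eval_continuous x).

Lemma canonical_embedding_linear : linear canonical_embedding.
Proof.
by move=> t x y; apply: dual_ext => f; exact: (dualP f t x y).
Qed.

Lemma canonical_embedding_isometry x : `|canonical_embedding x| = `|x|.
Proof.
apply/eqP; rewrite eq_le; apply/andP; split.
  apply: dual_norm_le => // f; rewrite [leRHS]mulrC; exact: (dual_norm_ub f x).
have [f [fL fx fn]] := norming_functional x.
have fC : (f : X -> R^o) \in continuous_functional.
  apply/continuous_functionalP; split; first exact: fL.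
  by exists 1 => y; rewrite mul1r.
have f1 : `|Dual fC| <= 1 by apply: dual_norm_le => // y; rewrite mul1r; exact: fx.
have := dual_norm_ub (canonical_embedding x) (Dual fC).
rewrite [X in `|X| <= _](_ : _ = `|x|); last exact: fn.
by rewrite normr_id => /le_trans; apply; exact: (ler_piMr (dual_norm_ge0 _) f1).
Qed.

End canonical_embedding.

Definition canonical_image (R : realType) (X : normedModType R) :
  {pred dual (dual X)} := fun u => `[< exists x, canonical_embedding x = u >].

Section canonical_image.
Context {R : realType} {X : completeNormedModType R}.
Local Notation J := (@canonical_embedding R X).

Lemma canonical_image_submod : submod_closed (@canonical_image R X).
Proof.
have J0 : J 0 = 0 by apply/eqP; rewrite -normr_eq0 canonical_embedding_isometry normr0.
split=> [|t _ _ /asboolP[x <-] /asboolP[y <-]]; apply/asboolP; first by exists 0.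
by exists (t *: x + y); rewrite canonical_embedding_linear.
Qed.

Lemma canonical_image_closed : closed [set u | u \in @canonical_image R X].
Proof.
move=> u uJ; apply/asboolP.
have JB x y : `|J x - J y| = `|x - y|.
  rewrite -canonical_embedding_isometry; congr (`|_|).
  have := canonical_embedding_linear (-1) y x; rewrite !scaleN1r => JE.
  by rewrite [x - y]addrC JE addrC.
pose G : set_system X := filter_from [set e : R | 0 < e] (fun e => [set x | `|u - J x| < e]).
have FG : ProperFilter G.
  apply: filter_from_proper; last first.
    move=> e /= e0; have [_ [/asboolP[x <-] /= xe]] := uJ _ (nbhsx_ballx u e e0).
    by exists x; move: xe; rewrite -ball_normE.
  apply: filter_from_filter; first by exists 1 => /=.
  move=> d e /= d0 e0; exists (Num.min d e); first by rewrite /= lt_min d0.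
  by move=> x /=; rewrite lt_min => /andP.
have uball (e : R) : 0 < e -> G [set x | `|u - J x| < e] by exists e.
have /cauchy_cvg/cvg_ex[l Gl] : cauchy G.
  apply: cauchy_exP => e e0.
  have e20 : 0 < e / 2 by rewrite divr_gt0.
  have [x /= ux] := filter_ex (uball _ e20).
  exists x; apply: filterS (uball _ e20) => y /= uy.
  rewrite -ball_normE/= -JB (splitr e).
  have -> : J x - J y = (u - J y) - (u - J x) by rewrite opprB [RHS]addrC addrA subrK.
  by rewrite (le_lt_trans (ler_normB _ _))// ltrD.
exists l; apply/eqP; rewrite eq_sym -subr_eq0 -normr_le0.
apply/ler_addgt0Pr => e e0; rewrite add0r.
have e20 : 0 < e / 2 by rewrite divr_gt0.
have lx : G [set x | `|l - x| <= e / 2] by have /cvgrPdist_le := (Gl : id @ G --> l); exact.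
have [x [/= ux {}lx]] := filter_ex (filterI (uball _ e20) lx).
rewrite -(subrK (J x) u) -addrA (le_trans (ler_normD _ _))// (splitr e).
by rewrite lerD ?(ltW ux)// JB distrC.
Qed.

End canonical_image.

Definition canonical_subspace (R : realType) (X : completeNormedModType R) :=
  ClosedSubspace (@canonical_image_submod R X) (@canonical_image_closed R X).

Definition bidual_quotient (R : realType) (X : completeNormedModType R)
  : completeNormedModType R := quotient_space (canonical_subspace X).

Section l1_properties.
Context {R : realType}.

Section index.
Context {G : choiceType}.
Implicit Types (a : G -> R) (A : set (G -> R)).

(* esum is +oo when a is not summable *)
Definition l1_sphere : set (G -> R) :=
  [set a | (\esum_(g in [set: G]) `|a g|%:E = 1)%E].

Context {X : completeNormedModType R}.
Implicit Types x : G -> X.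

Definition linf_norm x : R := sup [set `|x g| | g in [set: G]].

(* real-valued sup is 0 on empty or unbounded sets *)
Definition linf_sphere : set (G -> X) :=
  [set x | (exists M : R, forall g, `|x g| <= M) /\ linf_norm x = 1].

(* limit of the partial sums along the finite subsets of G *)
Definition l1_op a x : X := summability.sum (fun g => a g *: x g).

Lemma l1_op_finite a x (F : {fset G}) : (forall g, g \notin F -> a g = 0) ->
  l1_op a x = \sum_(g <- F) a g *: x g.
Proof.
move=> aF; apply: (@lim_near_cst X (@norm_hausdorff R X)).
  exact: summability.totally_filter.
exists F => // B /= FB; rewrite /summability.partial_sum.
transitivity (\sum_(g <- B) a g *: x g).
  exact: esym (big_seq_fsetE _ _ predT (fun g => a g *: x g)).
apply/esym; apply: (big_fset_incl _ FB).
by move=> g _ /aF ->; rewrite scale0r.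
Qed.

End index.

(* Extended-real valued: -oo when the unit sphere of l_oo(G, X) is empty      *)
(* (X = 0 or G empty), and +oo when A is empty and that sphere is not         *)
Definition l1_index (G : choiceType) (X : completeNormedModType R)
    (A : set (G -> R)) : \bar R :=
  ereal_sup [set d%:E | d in [set d : R | exists2 x : G -> X, linf_sphere x &
    (d%:E <= ereal_inf [set (`|l1_op a x|%:E)%E | a in A])%E]].

Definition regular_l1_property (P : completeNormedModType R -> Prop) : Prop :=
  exists (delta : R) (G : choiceType) (A : set (G -> R)),
    [/\ 0 < delta,
        A `<=` l1_sphere,
        forall a, A a -> finite_set [set g | a g != 0],
        forall a0 a, A a0 -> l1_sphere a ->
          (forall g, Num.sg (a0 g) = Num.sg (a g)) -> A a &
        forall X : completeNormedModType R,
          (~ P X <-> (0 < l1_index X A)%E) /\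
          ((0 < l1_index X A)%E <-> (delta%:E <= l1_index X A)%E)].

Definition coclass (P : completeNormedModType R -> Prop) :
    completeNormedModType R -> Prop :=
  fun X => P (bidual_quotient X).

End l1_properties.

(* Main.v *)
Require Import Defs.
From HB Require Import structures.
From mathcomp Require Import all_boot all_order all_algebra.
From mathcomp Require Import all_classical all_reals all_analysis.
From mathcomp Require Import finmap ring lra.

(* Let (Gamma, A) witness that P is a regular l_1-property.  As in James's    *)
(* characterization of reflexivity, a lower bound on dist(a(u), X) for        *)
(* u : Gamma -> X** is encoded by points x_(g, i) of X that approximate u_g   *)
(* weak* along a directed set of levels i = (E, n), with E a finite subset of *)
(* Gamma and n a natural number.  A vector b on Gamma x levels is a pattern   *)
(* of A if, for some a in A and levels i0 <= i1, it has the signs of a on     *)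
(* levels between i0 and i1 and the opposite signs on levels above i1.        *)
(* If all b(x) are large, take u to be a weak* limit of x along an            *)
(* ultrafilter: were a(u) close to a point of X, a convex combination b1 of   *)
(* far levels and a convex combination b2 of still farther levels would both  *)
(* be close to that point, and (b1 - b2) / 2 is a pattern.                    *)
(* Conversely, given u, closure of A under equality of signs makes the a(u)   *)
(* with a given sign pattern a convex set, so one element of X*** vanishing   *)
(* on X is large at all of them.  By Goldstine's theorem it is imitated in    *)
(* X*, and u is imitated in X, one level at a time, each level having only    *)
(* finitely many strictly smaller levels on which a functional must nearly    *)
(* vanish.                                                                    *)

Set Implicit Arguments.
Unset Strict Implicit.
Unset Printing Implicit Defensive.

Import Order.TTheory GRing.Theory Num.Theory.
Import numFieldNormedType.Exports.

Local Open Scope classical_set_scope.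
Local Open Scope ring_scope.

(** * Separation of convex sets and Goldstine's theorem *)

(** The gap between index 0 and index at least some constant comes from two estimates of different
    strength. If all patterns have values of norm at least r on a unit family of X, weak* limits
    ([weak_star_limit]) give, through [block_approximation] and [bidual_quotient_ge], a family in
    the unit ball of X** / X on which A has the same bound r. Conversely, index at least delta for A
    in X** / X forces the index of the patterns in X above a positive constant depending on delta
    alone ([annihilator_functional], [approximating_family], [coclass_index_ge]). As P is regular, a
    positive index of A is at least delta, so a positive index of the patterns is at least that
    constant. The change of sign inside a pattern makes it measure distance to X instead of size:
    half the difference of a near and a far combination cancels any point of X close to both. *)

Definition sublinear_prod (R : realType) (V : normedModType R) (p : V -> R)
  (_ : sublinear p) := (V * R^o)%type.

HB.instance Definition _ (R : realType) (V : normedModType R) (p : V -> R)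
  (sp : sublinear p) := GRing.Lmodule.on (sublinear_prod sp).

Section sublinear_prod_norm.
Context {R : realType} {V : normedModType R} (p : V -> R) (sp : sublinear p).
Local Notation W := (sublinear_prod sp).
Implicit Types (u v : W).

(** [norming_functional] speaks of norms, so p is turned into one: the maximum over both signs makes
    p x + t even, and the term |x| makes it definite. The proof [sp] is a parameter of the type
    because the norm axioms rest on it. *)
Definition sublinear_prod_norm u : R :=
  Num.max `|u.1| (Num.max (p u.1 + u.2) (p (- u.1) - u.2)).

Let norm_le u M : sublinear_prod_norm u <= M <->
  [/\ `|u.1| <= M, p u.1 + u.2 <= M & p (- u.1) - u.2 <= M].
Proof. by rewrite /sublinear_prod_norm !ge_max; split => [/and3P|] []// -> -> ->. Qed.

Let normD u v :
  sublinear_prod_norm (u + v) <= sublinear_prod_norm u + sublinear_prod_norm v.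
Proof.
have /norm_le[u1 u2 u3] := lexx (sublinear_prod_norm u).
have /norm_le[v1 v2 v3] := lexx (sublinear_prod_norm v).
apply/norm_le; split.
- by rewrite (le_trans (ler_normD _ _))// lerD.
- have := sp.1 u.1 v.1; rewrite -[(u + v).2]/((u.2 : R) + v.2); lra.
- have := sp.1 (- u.1) (- v.1).
  rewrite -opprD -[(u + v).2]/((u.2 : R) + v.2); lra.
Qed.

Let normZ_le (t : R) u :
  sublinear_prod_norm (t *: u) <= `|t| * sublinear_prod_norm u.
Proof.
have pos (s : R) v : 0 < s ->
    sublinear_prod_norm (s *: v) <= s * sublinear_prod_norm v.
  move=> s0; have /norm_le[v1 v2 v3] := lexx (sublinear_prod_norm v).
  apply/norm_le; rewrite -[(s *: v).1]/(s *: v.1) -[(s *: v).2]/(s * (v.2 : R)).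
  rewrite -scalerN !(sublinearZ _ sp)// normrZ gtr0_norm//.
  by rewrite -(mulrDr s (p v.1) v.2) -(mulrBr s (p (- v.1)) v.2) !ler_pM2l.
have [t0|t0|->] := ltgtP t 0; last 1 first.
- rewrite normr0 scale0r mul0r; apply/norm_le.
  rewrite -[(0 : W).1]/(0 : V) -[(0 : W).2]/(0 : R).
  by rewrite normr0 oppr0 sublinear0// addr0 subr0.
- have -> : sublinear_prod_norm (t *: u) = sublinear_prod_norm (- t *: u).
    rewrite scaleNr /sublinear_prod_norm normrN opprK; congr Num.max.
    by rewrite maxC [(- _).2]/(- ((t *: u).2 : R)) opprK.
  by rewrite ltr0_norm// pos// oppr_gt0.
- by rewrite gtr0_norm// pos.
Qed.

Let normZ (t : R) u :
  sublinear_prod_norm (t *: u) = `|t| * sublinear_prod_norm u.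
Proof.
apply/eqP; rewrite eq_le normZ_le/=.
have [->|t0] := eqVneq t 0.
  by rewrite normr0 mul0r scale0r /sublinear_prod_norm le_max normr_ge0.
have := normZ_le t^-1 (t *: u).
by rewrite scalerA mulVf// scale1r normfV ler_pdivlMl ?normr_gt0.
Qed.

Let norm_eq0 u : sublinear_prod_norm u = 0 -> u = 0.
Proof.
case: u => x t u0; have /norm_le[/= u1 u2 u3] := lexx (sublinear_prod_norm (x, t)).
move: u1 u2 u3; rewrite u0 normr_le0 => /eqP->; rewrite oppr0 sublinear0//.
by rewrite add0r => t0 t0'; congr pair; apply/eqP; rewrite eq_le t0; lra.
Qed.

HB.instance Definition _ := Lmodule_isNormed.Build R W normD normZ norm_eq0.

(* For t large the norm of (x, t) is p x + t, so a functional norming (0, 1)  *)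
(* is of the form (x, t) |-> f x + t with f <= p.                             *)
Lemma hahn_banach : exists f : V -> R,
  (forall t x y, f (t *: x + y) = t * f x + f y) /\ forall x, f x <= p x.
Proof.
have [F [FL Fle F01]] := norming_functional ((0, 1) : W).
have F1 : F ((0, 1) : W) = 1.
  rewrite F01 -[LHS]/(sublinear_prod_norm (0, 1)) /sublinear_prod_norm /=.
  by rewrite normr0 oppr0 sublinear0// !add0r [Num.max 1 _]max_l ?max_r//; lra.
exists (fun x => F ((x, 0) : W)); split=> [t x y|x].
  by rewrite -FL; congr F; apply: congr2 => //=; rewrite ?scaler0 ?addr0.
(* The first entry makes t nonnegative; with the others, p x + t dominates both |x| and p (- x) -
   t. *)
pose t := Num.max `|x| (Num.max (`|x| - p x) (p (- x) - p x)).
have /le_trans := le_trans (ler_norm _) (Fle ((x, t) : W)).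
have -> : F ((x, t) : W) = t + F ((x, 0) : W).
  rewrite -[X in X + _]mulr1 -F1 -FL; congr F.
  by apply: congr2 => /=; rewrite ?scaler0 ?add0r ?addr0 // [_ *: _]mulr1.
have [t1 t2 t3] : [/\ `|x| <= t, `|x| - p x <= t & p (- x) - p x <= t].
  by rewrite /t !le_max !lexx !orbT.
have x0 := normr_ge0 x.
suff -> : `|(x, t) : W| = p x + t by move=> /(_ _ (lexx _)); lra.
rewrite -[LHS]/(Num.max `|x| (Num.max (p x + t) (p (- x) - t))).
by rewrite [Num.max (_ + _) _]max_l ?max_r//; lra.
Qed.

End sublinear_prod_norm.

(** The infimum q of p (x + t k) - t c over t >= 0 and k in K is sublinear by convexity of K, and
    finite because c <= p on K. Since q <= p and q (- k) <= - c, any linear g <= q separates. *)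
Lemma convex_separation (R : realType) (V : normedModType R) (p : V -> R)
    (K : set V) (c : R) :
  sublinear p -> K !=set0 ->
  (forall t x y, K x -> K y -> 0 < t < 1 -> K (t *: x + (1 - t) *: y)) ->
  (forall x, K x -> c <= p x) ->
  exists g : V -> R, [/\ forall t x y, g (t *: x + y) = t * g x + g y,
    forall x, g x <= p x & forall x, K x -> c <= g x].
Proof.
move=> sp [k0 Kk0] Kconv Kc.
pose S x := [set p (x + z.1 *: z.2) - z.1 * c | z in [set z | 0 <= z.1 /\ K z.2]].
pose q x := inf (S x).
have Slb x : lbound (S x) (- p (- x)).
  move=> _ [[t k]/= [t0 Kk] <-]; have := sp.1 (x + t *: k) (- x).
  rewrite [x + _]addrC addrK; suff : t * c <= p (t *: k) by lra.
  move: t0; rewrite le_eqVlt => /predU1P[<-|t0].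
    by rewrite scale0r mul0r sublinear0.
  by rewrite sublinearZ// ler_pM2l// Kc.
have qle x t k : 0 <= t -> K k -> q x <= p (x + t *: k) - t * c.
  move=> t0 Kk; apply: ge_inf; last by exists (t, k).
  by exists (- p (- x)); exact: Slb.
have qge x d : (forall t k, 0 <= t -> K k -> d <= p (x + t *: k) - t * c) ->
    d <= q x.
  move=> h; apply: lb_le_inf; first by exists (p (x + 0 *: k0) - 0 * c); exists (0, k0).
  by move=> _ [[t k]/= [t0 Kk] <-]; exact: h.
have qp x : q x <= p x.
  by have := qle x 0 k0 (lexx 0) Kk0; rewrite scale0r addr0 mul0r subr0.
have comb t k s l : 0 <= t -> K k -> 0 <= s -> K l ->
    exists2 m, K m & t *: k + s *: l = (t + s) *: m.
  rewrite !le_eqVlt => /predU1P[<-|t0] Kk /predU1P[<-|s0] Kl.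
  - by exists k => //; rewrite addr0 !scale0r addr0.
  - by exists l => //; rewrite scale0r !add0r.
  - by exists k => //; rewrite scale0r !addr0.
  have ts0 : 0 < t + s by exact: addr_gt0.
  exists (t / (t + s) *: k + (1 - t / (t + s)) *: l).
    by apply: Kconv; rewrite ?divr_gt0//= ltr_pdivrMr// mul1r ltrDl.
  rewrite scalerDr !scalerA; congr (_ *: _ + _ *: _); field; exact: lt0r_neq0.
have sq : sublinear q.
  split=> [x y|t x t0].
    rewrite -lerBlDr; apply: (qge) => t k t0 Kk.
    rewrite lerBlDl -lerBlDr; apply: (qge) => s l s0 Kl.
    have [m Km E] := comb _ _ _ _ t0 Kk s0 Kl.
    have := qle (x + y) _ _ (addr_ge0 t0 s0) Km.
    by have := sp.1 (x + t *: k) (y + s *: l); rewrite addrACA E; lra.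
  rewrite mulrC -ler_pdivrMr//; apply: (qge) => s k s0 Kk.
  rewrite ler_pdivrMr//; apply: (le_trans (qle _ _ _ (mulr_ge0 (ltW t0) s0) Kk)).
  by rewrite -scalerA -scalerDr (sublinearZ _ sp)//; lra.
have [g [gL gq]] := hahn_banach sq.
exists g; split=> // [x|k Kk]; first exact: le_trans (gq x) (qp x).
have g0 : g 0 = 0 by have := gL 1 0 0; rewrite scale1r addr0; lra.
have gN : g (- k) = - g k.
  by have := gL (-1) k 0; rewrite addr0 scaleN1r mulN1r g0 addr0.
have := le_trans (gq (- k)) (qle (- k) 1 k ler01 Kk).
by rewrite scale1r mul1r addNr sublinear0// gN; lra.
Qed.

Lemma norm_separation (R : realType) (X : normedModType R) (K : set X) (c : R) :
  K !=set0 ->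
  (forall t x y, K x -> K y -> 0 < t < 1 -> K (t *: x + (1 - t) *: y)) ->
  (forall x, K x -> c <= `|x|) ->
  exists f : dual X, `|f| <= 1 /\ forall x, K x -> c <= f x.
Proof.
move=> K0 Kconv Kc.
have sn : sublinear (fun x : X => `|x|).
  by split=> [x y|t x t0]; rewrite ?ler_normD// normrZ gtr0_norm.
have [f [fL fn fc]] := convex_separation sn K0 Kconv Kc.
have f0 : f 0 = 0 by have := fL 1 0 0; rewrite scale1r addr0; lra.
have fb x : `|f x| <= `|x|.
  rewrite ler_norml fn andbT lerNl -normrN.
  by have := fL (-1) x 0; rewrite addr0 scaleN1r mulN1r f0 addr0 => <-.
have fC : (f : X -> R^o) \in continuous_functional.
  by apply/continuous_functionalP; split; [exact: fL|exists 1 => x; rewrite mul1r fb].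
by exists (Dual fC); split=> //; apply: dual_norm_le => // x; rewrite mul1r; exact: fb.
Qed.

Lemma dualN (R : realType) (X : normedModType R) (f : dual X) x : f (- x) = - f x.
Proof. by rewrite -scaleN1r dualZ mulN1r. Qed.

Lemma dualD (R : realType) (X : normedModType R) (f : dual X) x y :
  f (x + y) = f x + f y.
Proof. by have := dualP f 1 x y; rewrite scale1r mul1r. Qed.

Lemma dual_sum (R : realType) (X : normedModType R) (f : dual X) I (r : seq I)
  (P : pred I) (x : I -> X) : f (\sum_(i <- r | P i) x i) = \sum_(i <- r | P i) f (x i).
Proof. by apply: (big_morph f (dualD f) (dual0 f)). Qed.

(** Otherwise the vectors (g y - v g), for |y| <= M, form a convex set at l_1-distance at least e
    from 0. A separating functional is a combination h of the g with h y >= v h + e on that ball, so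
    - M |h| >= v h + e, against |v| <= M. *)
Lemma goldstine (R : realType) (Y : normedModType R) (v : dual (dual Y)) (M : R)
    (gs : seq (dual Y)) (e : R) :
  0 < M -> `|v| <= M -> 0 < e ->
  exists y : Y, `|y| <= M /\ forall g, g \in gs -> `|g y - v g| <= e.
Proof.
move=> M0 vM e0; apply: contrapT => noy.
(* At index [size gs] this is the default 0, so the extra coordinate of [w] is always 0. *)
pose G k : dual Y := nth 0 gs k.
pose w y : 'rV[R]_(size gs).+1 := \row_k (G k y - v (G k)).
pose p (z : 'rV[R]_(size gs).+1) := \sum_k `|z 0 k|.
have sp : sublinear p.
  split=> [x y|t x t0]; rewrite /p.
    by rewrite -big_split; apply: ler_sum => k _; rewrite mxE ler_normD.
  by rewrite mulr_sumr; apply: ler_sum => k _; rewrite mxE normrM gtr0_norm.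
have vZ t g : v (t *: g) = t * v g by rewrite dualZ.
have w0 : [set w y | y in [set y | `|y| <= M]] !=set0.
  by exists (w 0), 0; rewrite //= normr0 ltW.
have [| |z [gL _ ge]] := convex_separation (c := e) sp w0.
- move=> t _ _ [x /= xM <-] [y /= yM <-] /andP[t0 t1].
  exists (t *: x + (1 - t) *: y).
    rewrite /= (le_trans (ler_normD _ _))// !normrZ gtr0_norm// gtr0_norm ?subr_gt0//.
    have -> : M = t * M + (1 - t) * M by ring.
    by rewrite lerD// ler_pM2l// subr_gt0.
  by apply/rowP => k; rewrite !mxE dualD !dualZ; ring.
- move=> _ [y /= yM <-]; rewrite leNgt; apply/negP => pe.
  apply: noy; exists y; split=> // g /(nthP 0)[k ks <-].
  apply: (le_trans _ (ltW pe)).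
  rewrite /p (bigD1 (inord k))//= mxE inordK ?ltnS 1?ltnW//.
  by rewrite lerDl sumr_ge0.
have gD x y : z (x + y) = z x + z y by have := gL 1 x y; rewrite scale1r mul1r.
have g0 : z 0 = 0 by have := gD 0 0; rewrite addr0; lra.
have gZ t x : z (t *: x) = t * z x by have := gL t x 0; rewrite !addr0 g0 addr0.
pose h : dual Y := \sum_(k < (size gs).+1) z (delta_mx 0 k) *: G k.
have zw y : z (w y) = h y - v h.
  rewrite (row_sum_delta (w y)) (big_morph z gD g0) /h dual_sum.
  have -> : (\sum_(k < (size gs).+1) z (delta_mx 0 k) *: G k) y =
      \sum_(k < (size gs).+1) z (delta_mx 0 k) * G k y.
    by apply: (big_morph (fun f : dual Y => f y : R)).
  by rewrite -sumrB; apply: eq_bigr => k _; rewrite gZ mxE vZ; ring.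
have hy y : `|y| <= M -> e <= h y - v h by move=> yM; rewrite -zw; apply: (ge); exists y.
have vh : - v h <= M * `|h|.
  rewrite (le_trans (ler_norm _))// normrN (le_trans (dual_norm_ub v h))//.
  by rewrite ler_wpM2r.
have e_le : e <= M * `|h|.
  by have := hy 0; rewrite normr0 dual0 => /(_ (ltW M0)); lra.
(* Testing [hy] at the two multiples of x of norm M lowers the bound on h by e / M. *)
suff : `|h| <= `|h| - e / M by have := divr_gt0 e0 M0; lra.
apply: dual_norm_le => [|x]; first by rewrite subr_ge0 ler_pdivrMr// mulrC.
have [->|x0] := eqVneq x 0; first by rewrite dual0 !normr0 mulr0.
have nx : 0 < `|x| by rewrite normr_gt0.
have hx (s : R) : `|s| = M -> - (s / `|x| * h x) <= M * `|h| - e.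
  move=> sM; have := hy ((s / `|x|) *: x).
  rewrite normrZ normrM sM normfV normr_id mulfVK ?gt_eqF// dualZ => /(_ (lexx _)).
  by lra.
have := hx M (gtr0_norm M0); have := hx (- M).
rewrite normrN gtr0_norm// => /(_ erefl) h1 h2.
rewrite -ler_pdivrMr// -(ler_pM2l M0).
have -> : M * (`|h| - e / M) = M * `|h| - e by field; rewrite gt_eqF.
rewrite -[X in X * _ <= _]gtr0_norm// -[X in _ / X]gtr0_norm// -normfV -!normrM.
by rewrite ler_norml; lra.
Qed.

(** * Weak* limits and the index *)

(** Banach-Alaoglu, one functional at a time: the scalars f (z i) stay in a compact segment, so they
    converge along the ultrafilter, and linearity and the bound pass to the limit. *)
Lemma weak_star_limit (R : realType) (X : normedModType R) (I : Type)
    (U : set_system I) (z : I -> X) (M : R) :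
  UltraFilter U -> 0 <= M -> (forall i, `|z i| <= M) ->
  exists u : dual (dual X), `|u| <= M /\
    forall f : dual X, (f (z i) : R^o) @[i --> U] --> (u f : R^o).
Proof.
move=> UU M0 zM.
have /choice[u uU] (f : dual X) : exists l : R^o,
    `|l| <= M * `|f| /\ (f (z i) : R^o) @[i --> U] --> l.
  have [|l [/= lM lU]] := @segment_compact R (- (M * `|f|)) (M * `|f|)
      ((fun i => f (z i) : R) @ U) _.
    apply: (@filterS _ U _ _ _ _ (filterT : U setT)) => i _ /=.
    rewrite in_itv/= -ler_norml (le_trans (dual_norm_ub f _))// mulrC.
    by rewrite ler_wpM2r// dual_norm_ge0.
  exists l; rewrite ler_norml; split; first by move: lM; rewrite in_itv.
  move=> B lB; have [//|nB] := in_ultra_setVsetC ((fun i => f (z i)) @^-1` B) UU.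
  by have [c []] := lU (~` B) B nB lB.
have uL : linear (u : dual X -> R^o).
  move=> t f g.
  have h : (t * f (z i) + g (z i) : R^o) @[i --> U] --> (t * u f + u g : R^o).
    by apply: cvgD; [apply: cvgMr; exact: (uU f).2|exact: (uU g).2].
  exact: (cvg_unique _ (uU (t *: f + g)).2 h).
have uC : (u : dual X -> R^o) \in continuous_functional.
  by apply/continuous_functionalP; split=> //; exists M => f; exact: (uU f).1.
exists (Dual uC); split; last by move=> f; exact: (uU f).2.
by apply: dual_norm_le => // f; exact: (uU f).1.
Qed.

Section finitely_supported.
Context {R : realType} {G : choiceType}.
Implicit Types (a b : G -> R) (F : {fset G}).

Lemma finite_support_fset a : finite_set [set g | a g != 0] ->
  exists F, forall g, (g \in F) = (a g != 0).
Proof.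
move=> fa; exists (fset_set [set g | a g != 0]) => g.
by rewrite in_fset_set//; apply/idP/idP => [/set_mem//|ag]; exact: mem_set.
Qed.

Lemma l1_sphere_finite a F : (forall g, g \notin F -> a g = 0) ->
  l1_sphere a <-> \sum_(g <- F) `|a g| = 1.
Proof.
move=> aF.
have E : (\esum_(g in [set: G]) `|a g|%:E = (\sum_(g <- F) `|a g|)%:E)%E.
  rewrite -sumEFin fsbig_seq// -esum_fset//.
  rewrite [RHS]esum_mkcond; apply: eq_esum => g _.
  have [//|gF] := boolP (g \in [set` F]).
  by rewrite aF ?normr0//; move: gF; apply: contra => gF; exact: mem_set.
by rewrite /l1_sphere/= E; split => [[]|->].
Qed.

Lemma l1_sphere_single (g0 : G) : l1_sphere (fun g => (g == g0)%:R : R).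
Proof.
apply/(l1_sphere_finite (F := [fset g0]%fset)).
  by move=> g; rewrite inE => /negbTE ->.
by rewrite big_seq_fset1 eqxx normr1.
Qed.

Section index.
Context {X : completeNormedModType R}.
Implicit Types (x y : G -> X) (A : set (G -> R)).

Lemma linf_sphere_ub x g : linf_sphere x -> `|x g| <= 1.
Proof.
move=> [[M xM] <-]; apply: ub_le_sup; last by exists g.
by exists M => _ [h _ <-].
Qed.

Lemma linf_sphere_normalize y (M : R) : 0 < M -> (forall g, `|y g| <= M) ->
  (exists g, y g != 0) ->
  exists2 s, 0 < s <= M & linf_sphere (fun g => s^-1 *: y g).
Proof.
move=> M0 yM [g0 y0]; set S := [set `|y g| | g in [set: G]].
have uS : has_ubound S by exists M => _ [h _ <-].
have s0 : 0 < sup S.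
  by rewrite (@lt_le_trans _ _ `|y g0|) ?normr_gt0//; apply: ub_le_sup => //; exists g0.
have sM : sup S <= M by apply: ge_sup; [exists `|y g0|, g0|move=> _ [h _ <-]].
exists (sup S); first by rewrite s0.
have le1 g : `|(sup S)^-1 *: y g| <= 1.
  rewrite normrZ gtr0_norm ?invr_gt0// mulrC ler_pdivrMr// mul1r.
  by apply: ub_le_sup => //; exists g.
split; first by exists 1.
apply/eqP; rewrite eq_le; apply/andP; split.
  by apply: ge_sup; [exists `|(sup S)^-1 *: y g0|, g0|move=> _ [h _ <-]].
set L := linf_norm _.
have : sup S <= sup S * L.
  apply: ge_sup => [|_ [h _ <-]]; first by exists `|y g0|, g0.
  rewrite -[leLHS](mulVKf (lt0r_neq0 s0)) ler_pM2l//.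
  apply: ub_le_sup; first by exists 1 => _ [k _ <-].
  by exists h => //; rewrite normrZ gtr0_norm ?invr_gt0.
by rewrite -[leLHS]mulr1 ler_pM2l.
Qed.

Lemma l1_index_gt A (c : R) : (c%:E < l1_index X A)%E ->
  exists2 d, c < d & exists2 x : G -> X, linf_sphere x &
    forall a, A a -> d <= `|l1_op a x|.
Proof.
move=> /ereal_sup_gt[_ [d [x xs xA] <-]]; rewrite lte_fin => cd.
exists d => //; exists x => // a Aa; rewrite -lee_fin (le_trans xA)//.
by apply: ereal_inf_lbound; exists a.
Qed.

Lemma l1_index_ge A x (d : R) : linf_sphere x ->
  (forall a, A a -> d <= `|l1_op a x|) -> (d%:E <= l1_index X A)%E.
Proof.
move=> xs xA; apply: ereal_sup_ubound; exists d => //; exists x => //.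
by apply: le_ereal_inf_tmp => _ [a Aa <-]; rewrite lee_fin xA.
Qed.

Lemma l1_index_ge_bounded A y (d M : R) :
  0 < M -> (forall g, `|y g| <= M) -> (exists g, y g != 0) ->
  (forall a, A a -> finite_set [set g | a g != 0]) -> 0 <= d ->
  (forall a, A a -> d <= `|l1_op a y|) -> ((d / M)%:E <= l1_index X A)%E.
Proof.
move=> M0 yM y0 Af d0 dA; have [s /andP[s0 sM] ys] := linf_sphere_normalize M0 yM y0.
apply: (l1_index_ge ys) => a Aa; have [F aF] := finite_support_fset (Af _ Aa).
have aF0 g : g \notin F -> a g = 0 by rewrite aF negbK => /eqP.
have := dA _ Aa; rewrite !(l1_op_finite _ aF0).
under [X in _ -> _ <= `|X|]eq_bigr do rewrite scalerA mulrC -scalerA.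
rewrite -scaler_sumr normrZ gtr0_norm ?invr_gt0// => dF.
by rewrite mulrC; apply: ler_pM; rewrite ?invr_ge0 ?(ltW M0)// lef_pV2.
Qed.

End index.
End finitely_supported.

(** * From families in X to families in X** / X *)

Section level.
Context {G : choiceType}.
Implicit Types i j k : {fset G} * nat.

Definition level_le i j := (i.1 `<=` j.1)%fset && (i.2 <= j.2)%N.
(** Strictness concerns the number only: the family below is built by recursion on it, for all
    finite sets at once. *)
Definition level_lt i j := (i.1 `<=` j.1)%fset && (i.2 < j.2)%N.

Lemma level_le_refl i : level_le i i.
Proof. by rewrite /level_le fsubset_refl leqnn. Qed.

Lemma level_le_trans j i k : level_le i j -> level_le j k -> level_le i k.
Proof.
move=> /andP[ij1 ij2] /andP[jk1 jk2].
by rewrite /level_le (fsubset_trans ij1)// (leq_trans ij2).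
Qed.

Lemma level_ltW i j : level_lt i j -> level_le i j.
Proof. by move=> /andP[ij1 ij2]; rewrite /level_le ij1 ltnW. Qed.

Lemma level_le_lt_trans j i k : level_le i j -> level_lt j k -> level_lt i k.
Proof.
move=> /andP[ij1 ij2] /andP[jk1 jk2].
by rewrite /level_lt (fsubset_trans ij1)// (leq_ltn_trans ij2).
Qed.

Lemma level_lt_irr i : level_lt i i = false.
Proof. by rewrite /level_lt ltnn andbF. Qed.

Lemma level_lt_bounded (s : seq ({fset G} * nat)) :
  exists j, forall i, i \in s -> level_lt i j.
Proof.
elim: s => [|i s [j sj]]; first by exists (fset0, 0%N).
exists (i.1 `|` j.1, maxn i.2.+1 j.2)%fset => k; rewrite in_cons => /predU1P[->|ks].
  by rewrite /level_lt/= fsubsetUl leq_maxl.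
have /andP[kj1 kj2] := sj _ ks.
by rewrite /level_lt/= (fsubset_trans kj1) ?fsubsetUr// (leq_trans kj2)// leq_maxr.
Qed.

Lemma level_ultrafilter : exists U : set_system ({fset G} * nat),
  UltraFilter U /\ forall i, U [set j | level_le i j].
Proof.
pose tails := filter_from [set: {fset G} * nat] (fun i => [set j | level_le i j]).
have Ft : ProperFilter tails.
  apply: filter_from_proper => [|i _]; last by exists i; exact: level_le_refl.
  apply: filter_from_filter; first by exists (fset0, 0%N).
  move=> i j _ _; have [k ijk] := level_lt_bounded [:: i; j].
  have [ik jk] : level_le i k /\ level_le j k.
    by split; apply: level_ltW; apply: ijk; rewrite !in_cons eqxx ?orbT.
  by exists k => // l /= kl; split; apply: level_le_trans kl.
have [U [UU tU]] := ultraFilterLemma Ft.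
by exists U; split=> // i; apply: tU; exists i.
Qed.

End level.

(** * Patterns and the blocks they are made of *)

Section coclass_patterns.
Context {R : realType} {G : choiceType}.
Local Notation level := ({fset G} * nat)%type.
Implicit Types (A : set (G -> R)) (a : G -> R) (b : G * level -> R).
Implicit Types (i j : level) (B : {fset G * level}).

(** The support of a must lie in the finite set of i0 because the functionals attached to a level
    handle only sign patterns supported in its set. Apart from normalization only the signs of b
    enter, which gives closure under equal signs. *)
Definition coclass_patterns A : set (G * level -> R) :=
  [set b | [/\ l1_sphere b, finite_set [set g | b g != 0] &
    exists a i0 i1, [/\ A a, forall g, a g != 0 -> g \in i0.1, level_le i0 i1 &
      forall g i, b (g, i) != 0 ->
        level_le i0 i /\ level_lt i i1 /\ 0 < b (g, i) * a g \/
        level_le i1 i /\ b (g, i) * a g < 0]]].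

(** One half of a pattern, up to scale and sign. Only signs are tied to a, not proportions. *)
Definition block a i0 B b :=
  [/\ forall g, g \notin B -> b g = 0, \sum_(g <- B) `|b g| = 1 &
      forall g i, b (g, i) != 0 -> level_le i0 i /\ 0 < b (g, i) * a g].

Lemma sum_fsetUl (V : zmodType) B B' (c : G * level -> V) :
  (forall g, g \notin B -> c g = 0) ->
  \sum_(g <- (B `|` B')%fset) c g = \sum_(g <- B) c g.
Proof.
move=> cB; apply/esym; apply: (big_fset_incl _ (fsubsetUl B B')) => g _.
exact: cB.
Qed.

Lemma sum_fsetUr (V : zmodType) B B' (c : G * level -> V) :
  (forall g, g \notin B' -> c g = 0) ->
  \sum_(g <- (B `|` B')%fset) c g = \sum_(g <- B') c g.
Proof. by rewrite fsetUC; exact: sum_fsetUl. Qed.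

(** On blocks of the same a the absolute value is linear, so convex combinations keep l_1-norm 1. *)
Lemma block_norm a i0 B b g : block a i0 B b -> `|b g| = Num.sg (a g.1) * b g.
Proof.
case: g => g i [_ _ bP]; have [->|b0] := eqVneq (b (g, i)) 0; first by rewrite normr0 mulr0.
have [_ ba] := bP _ _ b0; case: (sgrP (a g)) ba => [->|a0|a0].
- by rewrite mulr0 ltxx.
- by rewrite pmulr_lgt0// => /gtr0_norm->; rewrite mul1r.
- by rewrite nmulr_lgt0// => /ltr0_norm->; rewrite mulN1r.
Qed.

Lemma block_convex a i0 B b B' b' (t : R) : 0 < t < 1 ->
  block a i0 B b -> block a i0 B' b' ->
  block a i0 (B `|` B')%fset (fun g => t * b g + (1 - t) * b' g).
Proof.
move=> /andP[t0 t1] bb bb'; have [b0 b1 bP] := bb; have [b0' b1' bP'] := bb'.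
have cP g i : t * b (g, i) + (1 - t) * b' (g, i) != 0 ->
    level_le i0 i /\ 0 < (t * b (g, i) + (1 - t) * b' (g, i)) * a g.
  have t1' : 0 < 1 - t by rewrite subr_gt0.
  have [->|c0] := eqVneq (b (g, i)) 0; have [->|c0'] := eqVneq (b' (g, i)) 0.
  - by rewrite !mulr0 addr0 eqxx.
  - move=> _; have [ii ca] := bP' _ _ c0'; split=> //.
    by rewrite mulr0 add0r -mulrA mulr_gt0.
  - move=> _; have [ii ca] := bP _ _ c0; split=> //.
    by rewrite mulr0 addr0 -mulrA mulr_gt0.
  - move=> _; have [ii ca] := bP _ _ c0; have [_ ca'] := bP' _ _ c0'; split=> //.
    by rewrite mulrDl -!mulrA addr_gt0// mulr_gt0.
have c0 g : g \notin (B `|` B')%fset -> t * b g + (1 - t) * b' g = 0.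
  by rewrite in_fsetU negb_or => /andP[/b0-> /b0'->]; rewrite !mulr0 addr0.
split=> //.
transitivity (\sum_(g <- (B `|` B')%fset) (t * `|b g| + (1 - t) * `|b' g|)).
  apply: eq_bigr => g _; rewrite (block_norm _ bb) (block_norm _ bb').
  have -> : `|t * b g + (1 - t) * b' g| =
      Num.sg (a g.1) * (t * b g + (1 - t) * b' g); last by ring.
  have [->|] := eqVneq (t * b g + (1 - t) * b' g) 0; first by rewrite normr0 mulr0.
  case: g => g i /cP[_]; case: (sgrP (a g)) => [->|a0|a0].
  - by rewrite mulr0 ltxx.
  - by rewrite pmulr_lgt0// => /gtr0_norm->; rewrite mul1r.
  - by rewrite nmulr_lgt0// => /ltr0_norm->; rewrite mulN1r.
rewrite big_split -!mulr_sumr/= (@sum_fsetUl _ B B' (fun g => `|b g|)); last first.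
  by move=> g /b0->; rewrite normr0.
rewrite (@sum_fsetUr _ B B' (fun g => `|b' g|)); last first.
  by move=> g /b0'->; rewrite normr0.
by rewrite b1 b1'; ring.
Qed.

End coclass_patterns.

Lemma quotient_map_eq_canonical (R : realType) (X : completeNormedModType R)
    (u v : dual (dual X)) :
  quotient_map (canonical_subspace X) u = quotient_map (canonical_subspace X) v <->
  exists x, canonical_embedding x = u - v.
Proof.
by rewrite quotient_map_eq; split => [/asboolP|ux]//; apply/asboolP.
Qed.

Lemma quotient_map_sum (R : realType) (V : normedModType R) (S : closedSubspace V)
    (I : Type) (r : seq I) (c : I -> R) (u : I -> V) :
  quotient_map S (\sum_(i <- r) c i *: u i) = \sum_(i <- r) c i *: quotient_map S (u i).
Proof.
rewrite (big_morph _ (quotient_mapD S) (quotient_map0 S)).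
by apply: eq_bigr => i _; rewrite quotient_mapZ.
Qed.

Section bidual_limits.
Context {R : realType} {G : choiceType} {X : completeNormedModType R}.
Local Notation level := ({fset G} * nat)%type.
Implicit Types (A : set (G -> R)) (a : G -> R) (b : G * level -> R).
Implicit Types (i j : level) (B : {fset G * level}).
Variables (U : set_system level) (y : G * level -> X) (u : G -> dual (dual X)).
Hypothesis UU : UltraFilter U.
Hypothesis Utail : forall i, U [set j | level_le i j].
Hypothesis yu : forall g (f : dual X), (f (y (g, i)) : R^o) @[i --> U] --> (u g f : R^o).

Let block_single a i0 i (F : {fset G}) : level_le i0 i ->
  (forall g, (g \in F) = (a g != 0)) -> \sum_(g <- F) `|a g| = 1 ->
  exists B b, block a i0 B b /\
    \sum_(g <- B) b g *: y g = \sum_(g <- F) a g *: y (g, i).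
Proof.
move=> i0i aF a1; exists [fset (g, i) | g in F]%fset.
exists (fun g => if g.2 == i then a g.1 else 0).
have inj : {in F &, injective (fun g => (g, i))} by move=> g h _ _ [].
split; last by rewrite big_imfset//=; apply: eq_bigr => g _; rewrite /= eqxx.
split=> [[g j]/=|/=|g j/=].
- case: eqVneq => [->|//] gF; apply/eqP; apply: contraNT gF => a0.
  by apply/imfsetP; exists g => //=; rewrite aF.
- by rewrite big_imfset//=; under eq_bigr do rewrite /= eqxx.
- case: (eqVneq j i) => [->|_ /eqP//] a0; split=> //.
  by rewrite -expr2 exprn_even_gt0.
Qed.

(* Otherwise Hahn-Banach separates x from all blocks, hence from the limit.   *)
Lemma block_approximation a i0 (F : {fset G}) (x : X) (d : R) :
  (forall g, (g \in F) = (a g != 0)) -> \sum_(g <- F) `|a g| = 1 ->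
  `|\sum_(g <- F) a g *: u g - canonical_embedding x| < d ->
  exists B b, block a i0 B b /\ `|\sum_(g <- B) b g *: y g - x| < d.
Proof.
move=> aF a1 ud; apply: contrapT => nob.
pose K := [set z | exists B b, block a i0 B b /\ z = \sum_(g <- B) b g *: y g - x].
have K0 : K !=set0.
  have [B [b [bb _]]] := block_single (level_le_refl i0) aF a1.
  by exists (\sum_(g <- B) b g *: y g - x), B, b.
have [| |h [h1 hd]] := norm_separation (c := d) K0.
- move=> t _ _ [B [b [bb ->]]] [B' [b' [bb' ->]]] t01.
  exists (B `|` B')%fset, (fun g => t * b g + (1 - t) * b' g).
  split; first exact: block_convex.
  under [in RHS]eq_bigr do rewrite scalerDl -!scalerA.
  have [b0 _ _] := bb; have [b0' _ _] := bb'.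
  rewrite big_split -!scaler_sumr/= (@sum_fsetUl _ _ B B' (fun g => b g *: y g)); last first.
    by move=> g /b0->; rewrite scale0r.
  rewrite (@sum_fsetUr _ _ B B' (fun g => b' g *: y g)); last first.
    by move=> g /b0'->; rewrite scale0r.
  rewrite !scalerBr addrACA -opprD -scalerDl; congr (_ - _).
  by rewrite addrC subrK scale1r.
- move=> _ [B [b [bb ->]]]; rewrite leNgt; apply/negP => bd.
  by apply: nob; exists B, b.
have lim : (\sum_(g <- F) a g * h (y (g, i)) : R^o) @[i --> U] -->
    (\sum_(g <- F) a g * u g h : R^o).
  apply: cvg_big => [|g _]; first exact: add_continuous.
  by apply: cvgMr; exact: yu.
(* The copies of a at single levels above [i0] are blocks; the bound on them survives the limit
   along U. *)
have : d + h x <= \sum_(g <- F) a g * u g h.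
  apply: (cvgr_to_ge lim); apply: filterS (Utail i0) => i /= i0i.
  have [B [b [bb bE]]] := block_single i0i aF a1.
  have := hd _ (ex_intro _ B (ex_intro _ b (conj bb erefl))); rewrite bE dualD dualN dual_sum.
  rewrite (eq_bigr (fun g => a g * h (y (g, i)))) => [|g _]; last exact: dualZ.
  rewrite lerBrDr; exact.
have : (\sum_(g <- F) a g *: u g - canonical_embedding x) h =
    \sum_(g <- F) a g * u g h - h x.
  congr (_ - _); exact: (big_morph (fun w : dual (dual X) => w h : R)).
have := dual_norm_ub (\sum_(g <- F) a g *: u g - canonical_embedding x) h.
move=> + E; rewrite E => /ler_normlP[_ wh].
have : dual_norm (\sum_(g <- F) a g *: u g - canonical_embedding x) * `|h| < d.
  apply: le_lt_trans ud; rewrite -dual_normE.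
  by rewrite ler_piMr.
by lra.
Qed.

(** If a(u) were within less than d of x in X, two blocks on disjoint levels would have values
    within less than d of x; their half difference is a pattern with value of norm less than d. *)
Lemma bidual_quotient_ge A (d : R) :
  A `<=` l1_sphere -> (forall a, A a -> finite_set [set g | a g != 0]) ->
  (forall b, coclass_patterns A b -> d <= `|l1_op b y|) ->
  forall a, A a ->
    d <= `|l1_op a (fun g => quotient_map (canonical_subspace X) (u g)
                             : bidual_quotient X)|.
Proof.
move=> As Af Ad a Aa; have [F aF] := finite_support_fset (Af _ Aa).
have aF0 g : g \notin F -> a g = 0 by rewrite aF negbK => /eqP.
have a1 := (l1_sphere_finite aF0).1 (As _ Aa).
rewrite (l1_op_finite _ aF0) -quotient_map_sum leNgt; apply/negP => ud.
set w := \sum_(g <- F) a g *: u g in ud.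
have [w' w'w] := quotient_norm_lift (quotient_map (canonical_subspace X) w)
  (etrans (subr_gt0 _ _) ud).
rewrite addrC subrK => w'd.
have /quotient_map_eq_canonical[x xw] := esym w'w.
have approx i : exists B b, block a i B b /\ `|\sum_(g <- B) b g *: y g - x| < d.
  by apply: (block_approximation _ aF a1); rewrite -/w xw opprB addrC subrK.
have [B1 [b1 [bb1 d1]]] := approx (F, 0%N).
(* Every level in the support of [b1] is strictly below [i1], where [b2] begins. *)
have [i1 Bi1] := level_lt_bounded ((F, 0%N) :: [seq g.2 | g <- B1]).
have [B2 [b2 [bb2 d2]]] := approx i1.
have [b10 b11 b1P] := bb1; have [b20 b21 b2P] := bb2.
pose b g := 2^-1 * (b1 g - b2 g).
have disj g : b1 g = 0 \/ b2 g = 0.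
  have [|n1] := eqVneq (b1 g) 0; first by left.
  have [|n2] := eqVneq (b2 g) 0; first by right.
  have gB1 : g \in B1 by apply: contraNT n1 => /b10->.
  have : level_lt g.2 i1 by apply: Bi1; rewrite in_cons map_f ?orbT.
  case: g n2 {n1 gB1} => g i /b2P[i1i _] /= /(level_le_lt_trans i1i).
  by rewrite level_lt_irr.
have b0 g : g \notin (B1 `|` B2)%fset -> b g = 0.
  by rewrite in_fsetU negb_or /b => /andP[/b10-> /b20->]; rewrite subrr mulr0.
have bs : l1_sphere b.
  apply/(l1_sphere_finite b0).
  rewrite (eq_bigr (fun g => 2^-1 * `|b1 g| + 2^-1 * `|b2 g|)) => [|g _]; last first.
    rewrite /b normrM gtr0_norm ?invr_gt0// -mulrDr.
    by case: (disj g) => ->; rewrite normr0 ?subr0 ?addr0// sub0r normrN add0r.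
  rewrite big_split -!mulr_sumr/= (@sum_fsetUl _ _ B1 B2 (fun g => `|b1 g|)); last first.
    by move=> g /b10->; rewrite normr0.
  rewrite (@sum_fsetUr _ _ B1 B2 (fun g => `|b2 g|)); last first.
    by move=> g /b20->; rewrite normr0.
  by rewrite b11 b21; field.
have bf : finite_set [set g | b g != 0].
  apply: (sub_finite_set _ (finite_fset (B1 `|` B2)%fset)) => g /= bg.
  by apply: contraNT bg => /b0->.
have /Ad : coclass_patterns A b.
  split=> //; exists a, (F, 0%N), i1; split=> // [g|| g i].
  - by rewrite -aF.
  - by apply: level_ltW; apply: Bi1; rewrite mem_head.
  have h2 : 0 < 2^-1 :> R by rewrite invr_gt0.
  rewrite /b -mulrA pmulr_rgt0// pmulr_rlt0//.
  case: (disj (g, i)) => E; rewrite E ?subr0 ?sub0r mulf_eq0 invr_eq0 pnatr_eq0/=.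
    by rewrite oppr_eq0 mulNr oppr_lt0 => /b2P; right.
  move=> n1; left; have [? ?] := b1P _ _ n1; split=> //; split=> //.
  apply: Bi1; rewrite in_cons; apply/orP; right.
  by apply/mapP; exists (g, i) => //; apply: contraNT n1 => /b10->.
rewrite (l1_op_finite _ b0) leNgt => /negP; apply.
have -> : \sum_(g <- (B1 `|` B2)%fset) b g *: y g =
    2^-1 *: ((\sum_(g <- B1) b1 g *: y g - x) - (\sum_(g <- B2) b2 g *: y g - x)).
  rewrite opprB addrA subrK.
  rewrite -(@sum_fsetUl _ _ B1 B2 (fun g => b1 g *: y g)); last first.
    by move=> g /b10->; rewrite scale0r.
  rewrite -(@sum_fsetUr _ _ B1 B2 (fun g => b2 g *: y g)); last first.
    by move=> g /b20->; rewrite scale0r.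
  rewrite -sumrB scaler_sumr; apply: eq_bigr => g _.
  by rewrite -scalerBl scalerA.
rewrite normrZ gtr0_norm ?invr_gt0//.
have := ler_normB (\sum_(g <- B1) b1 g *: y g - x) (\sum_(g <- B2) b2 g *: y g - x).
by lra.
Qed.

End bidual_limits.

(** * From families in X** / X to families in X *)

Lemma strong_dependent_choice (T : Type) (t0 : T)
    (P : nat -> (nat -> T) -> T -> Prop) :
  (forall n h h' t, (forall k, (k < n)%N -> h k = h' k) -> P n h t -> P n h' t) ->
  (forall n h, exists t, P n h t) -> exists s, forall n, P n s (s n).
Proof.
move=> Pext Pex; have [f fP] := choice (fun nh : nat * (nat -> T) => Pex nh.1 nh.2).
(* [build n] holds the first n choices and the junk value [t0] beyond; [P n] reads only those first
   n. *)
pose fix build n : nat -> T :=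
  if n is m.+1 then fun k => if k == m then f (m, build m) else build m k
  else fun=> t0.
exists (fun n => f (n, build n)) => n; apply: Pext (fP (n, build n)) => /=.
elim: n => // n ih k; rewrite ltnS leq_eqVlt /= => /predU1P[->|kn].
  by rewrite eqxx.
by rewrite ltn_eqF// ih.
Qed.

(** The second vector may vanish so that signed unit vectors, which are only limits of a sign
    pattern, can be mixed in. *)
Lemma sgr_convex (R : realType) (s b b' t : R) : 0 < t < 1 ->
  Num.sg b = Num.sg s -> b' = 0 \/ Num.sg b' = Num.sg s ->
  Num.sg (t * b + (1 - t) * b') = Num.sg s.
Proof.
move=> /andP[t0 t1] bs b's; have t1' : 0 < 1 - t by rewrite subr_gt0.
case: (sgrP s) bs b's => [_|s0|s0] /eqP.
- rewrite sgr_eq0 => /eqP-> b'0; have -> : b' = 0 by case: b'0 => // /eqP; rewrite sgr_eq0 => /eqP.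
  by rewrite !mulr0 addr0 sgr0.
- rewrite sgr_cp0 => b0 b's; apply/eqP; rewrite sgr_cp0.
  rewrite ltr_pwDl ?mulr_gt0// mulr_ge0 ?(ltW t1')//.
  by case: b's => [->//|/eqP]; rewrite sgr_cp0 => /ltW.
- rewrite sgr_cp0 => b0 b's; apply/eqP; rewrite sgr_cp0.
  rewrite ltr_nwDl ?pmulr_rlt0// mulr_ge0_le0 ?(ltW t1')//.
  by case: b's => [->//|/eqP]; rewrite sgr_cp0 => /ltW.
Qed.

(** Let t tend to 0. This carries a bound from a sign pattern to its boundary. *)
Lemma convex_limit_ge (R : realType) (c p q : R) :
  (forall t, 0 < t < 1 -> c <= t * p + (1 - t) * q) -> c <= q.
Proof.
move=> h; rewrite leNgt; apply/negP => qc.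
have c0 : 0 < c - q by rewrite subr_gt0.
set N := `|p - q| + (c - q); have N0 : 0 < N by rewrite ltr_wpDl.
set t := (c - q) / (2 * N).
have tN : t * N = (c - q) / 2 by rewrite /t; field; rewrite gt_eqF.
have t0 : 0 < t by rewrite divr_gt0// mulr_gt0.
have t1 : t < 1.
  rewrite /t ltr_pdivrMr ?mulr_gt0// mul1r.
  by have := normr_ge0 (p - q); rewrite /N; lra.
have := h t; rewrite t0 t1 => /(_ isT).
have : t * (p - q) <= t * N.
  by rewrite ler_pM2l// (le_trans (ler_norm _))// /N lerDl ltW.
by rewrite tN; lra.
Qed.

Section bidual_functionals.
Context {R : realType} {G : choiceType} {X : completeNormedModType R}.
Implicit Types (A : set (G -> R)) (a : G -> R).

(* The sign pattern of a yields a convex set of combinations of y, which      *)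
(* Hahn-Banach separates from 0 by a single functional.                       *)
Lemma sign_functional (Y : completeNormedModType R) A (y : G -> Y) (c : R) a :
  (forall a, A a -> finite_set [set g | a g != 0]) -> A `<=` l1_sphere ->
  (forall a b, A a -> l1_sphere b ->
    (forall g, Num.sg (a g) = Num.sg (b g)) -> A b) ->
  (forall a, A a -> c <= `|l1_op a y|) -> A a ->
  exists f : dual Y, `|f| <= 1 /\
    forall g, a g != 0 -> c <= Num.sg (a g) * f (y g).
Proof.
move=> Af As Asg Ac Aa; have [F aF] := finite_support_fset (Af _ Aa).
have aF0 g : g \notin F -> a g = 0 by rewrite aF negbK => /eqP.
have bF b : (forall g, Num.sg (b g) = Num.sg (a g)) -> forall g, g \notin F -> b g = 0.
  by move=> ba g /aF0 ag; apply/eqP; rewrite -sgr_eq0 ba ag sgr0.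
pose same b := (forall g, Num.sg (b g) = Num.sg (a g)) /\ \sum_(g <- F) `|b g| = 1.
pose val b := \sum_(g <- F) b g *: y g.
have sameA b : same b -> c <= `|val b|.
  move=> [ba b1]; have b0 := bF _ ba; rewrite /val -(l1_op_finite _ b0).
  by apply: Ac; apply: (Asg a) => //; apply/(l1_sphere_finite b0).
have asame : same a by split=> //; apply/(l1_sphere_finite aF0)/As.
have norm_sum b b' (t : R) : 0 < t < 1 -> (forall g, Num.sg (b g) = Num.sg (a g)) ->
    (forall g, b' g = 0 \/ Num.sg (b' g) = Num.sg (a g)) ->
    \sum_(g <- F) `|b g| = 1 -> \sum_(g <- F) `|b' g| = 1 ->
    same (fun g => t * b g + (1 - t) * b' g).
  move=> t01 ba b'a b1 b1'; split=> [g|]; first exact: sgr_convex.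
  transitivity (\sum_(g <- F) (t * `|b g| + (1 - t) * `|b' g|)); last first.
    by rewrite big_split -!mulr_sumr/= b1 b1'; ring.
  apply: eq_bigr => g _; rewrite normrEsg (sgr_convex t01 (ba g))//.
  rewrite [in RHS]normrEsg ba; have -> : `|b' g| = Num.sg (a g) * b' g; last by ring.
  by case: (b'a g) => [->|<-]; rewrite ?normr0 ?mulr0// normrEsg.
have valD b b' (t : R) : val (fun g => t * b g + (1 - t) * b' g) =
    t *: val b + (1 - t) *: val b'.
  rewrite /val !scaler_sumr -big_split/=; apply: eq_bigr => g _.
  by rewrite [LHS]scalerDl !scalerA.
have [| | |f [f1 fc]] := norm_separation (c := c) (K := [set val b | b in same]).
- by exists (val a), a.
- move=> t _ _ [b [ba b1] <-] [b' [b'a b1'] <-] t01; rewrite -valD.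
  exists (fun g => t * b g + (1 - t) * b' g) => //.
  by apply: norm_sum => // g; right.
- by move=> _ [b bs <-]; exact: sameA.
exists f; split=> // g ag.
(* This signed unit vector may lie outside the pattern of a, but t a + (1 - t) e lies in it for 0 <
   t < 1. *)
pose e h : R := if h == g then Num.sg (a g) else 0.
have gF : g \in F by rewrite aF.
have vale : val e = Num.sg (a g) *: y g.
  rewrite /val (big_fsetD1 g gF)/= big1_fset ?addr0 => [|h].
    by rewrite /e eqxx.
  by rewrite /e in_fsetD1 => /andP[/negbTE-> _] _; rewrite scale0r.
rewrite -dualZ -vale; apply: (@convex_limit_ge _ _ (f (val a))) => t t01.
rewrite -[X in _ + X]dualZ -dualP -valD; apply: fc.
exists (fun g => t * a g + (1 - t) * e g) => //.
apply: norm_sum => //; [|exact: asame.2|].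
- move=> h; rewrite /e; case: eqVneq => [->|]; last by left.
  by right; rewrite sgr_id.
- rewrite (big_fsetD1 g gF)/= big1_fset ?addr0 => [|h].
    by rewrite /e eqxx normr_sg ag.
  by rewrite /e in_fsetD1 => /andP[/negbTE-> _] _; rewrite normr0.
Qed.

(** A functional on X** / X composed with the quotient map vanishes on X. *)
Lemma annihilator_functional A (u : G -> dual (dual X)) (c : R) a :
  (forall a, A a -> finite_set [set g | a g != 0]) -> A `<=` l1_sphere ->
  (forall a b, A a -> l1_sphere b ->
    (forall g, Num.sg (a g) = Num.sg (b g)) -> A b) ->
  (forall a, A a -> c <= `|l1_op a (fun g =>
     quotient_map (canonical_subspace X) (u g) : bidual_quotient X)|) -> A a ->
  exists v : dual (dual (dual X)), [/\ `|v| <= 1,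
    forall x, v (canonical_embedding x) = 0 &
    forall g, a g != 0 -> c <= Num.sg (a g) * v (u g)].
Proof.
move=> Af As Asg Ac Aa; have [f [f1 fc]] := sign_functional Af As Asg Ac Aa.
pose v w : R^o := f (quotient_map (canonical_subspace X) w).
have vb w : `|v w| <= `|w|.
  rewrite (le_trans (dual_norm_ub f _))// (le_trans (ler_wpM2r _ f1))// mul1r.
  exact: quotient_norm_le.
have vC : (v : dual (dual X) -> R^o) \in continuous_functional.
  apply/continuous_functionalP; split; last by exists 1 => w; rewrite mul1r.
  by move=> t w w'; rewrite /v quotient_mapD quotient_mapZ dualP.
exists (Dual vC); split=> // [|x].
  by apply: dual_norm_le => // w; rewrite mul1r; exact: vb.
rewrite -[LHS]/(f (quotient_map (canonical_subspace X) (canonical_embedding x))).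
have -> : quotient_map (canonical_subspace X) (canonical_embedding x) =
          quotient_map (canonical_subspace X) 0.
  by apply/quotient_map_eq_canonical; exists x; rewrite subr0.
by rewrite quotient_map0 dual0.
Qed.

End bidual_functionals.

(** * Construction of functionals and points, level by level *)

Section approximating_family.
Context {R : realType} {G : choiceType} {X : completeNormedModType R}.
Local Notation level := ({fset G} * nat)%type.
Implicit Types (a : G -> R) (f : dual X) (i j : level) (E : {fset G}).
Variables (A : set (G -> R)) (u : G -> dual (dual X)) (c e : R).
Hypothesis e0 : 0 < e.
Hypothesis u2 : forall g, `|u g| <= 2.
Hypothesis Afunctional : forall a, A a -> exists v : dual (dual (dual X)),
  [/\ `|v| <= 1, forall x, v (canonical_embedding x) = 0 &
    forall g, a g != 0 -> c <= Num.sg (a g) * v (u g)].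

(** Goldstine's theorem for the space X*, tested on the points of [xs], where v vanishes, and on the
    u g with g in E. *)
Let one_functional E (xs : seq X) a : A a -> (forall g, a g != 0 -> g \in E) ->
  exists f, [/\ `|f| <= 1, forall x, x \in xs -> `|f x| <= e &
    forall g, a g != 0 -> c - e <= Num.sg (a g) * u g f].
Proof.
move=> Aa aE; have [v [v1 v0 vc]] := Afunctional Aa.
have [f [f1 fv]] := goldstine
  ([seq canonical_embedding x | x <- xs] ++ [seq u g | g <- enum_fset E]) ltr01 v1 e0.
exists f; split=> // [x xs_x|g ag].
  have := fv (canonical_embedding x); rewrite v0 subr0; apply.
  by rewrite mem_cat map_f.
have : `|u g f - v (u g)| <= e by apply: fv; rewrite mem_cat (map_f u) ?orbT ?aE.
have := vc _ ag; case: (sgrP (a g)) ag => [//|a0|a0] _.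
  by rewrite !mul1r ler_norml; lra.
by rewrite !mulN1r ler_norml; lra.
Qed.

(* Only the signs of a matter, and on E there are finitely many of them.      *)
Let functionals E (xs : seq X) : exists fs : seq (dual X),
  (forall f, f \in fs -> `|f| <= 1 /\ forall x, x \in xs -> `|f x| <= e) /\
  forall a, A a -> (forall g, a g != 0 -> g \in E) ->
    exists2 f, f \in fs & forall g, a g != 0 -> c - e <= Num.sg (a g) * u g f.
Proof.
pose pattern a := [ffun g : E => (0 < a (val g), a (val g) < 0)].
have patternE a a' : (forall g, a g != 0 -> g \in E) ->
    (forall g, a' g != 0 -> g \in E) -> pattern a = pattern a' ->
    forall g, Num.sg (a g) = Num.sg (a' g).
  move=> aE a'E aa' g; have [gE|gE] := boolP (g \in E).
    have := congr1 (fun p : {ffun E -> bool * bool} => p [` gE]%fset) aa'.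
    rewrite !ffunE/=.
    by case: (sgrP (a g)) => _; case: (sgrP (a' g)) => _.
  have -> : a g = 0 by apply/eqP; apply: contraNT gE => /aE.
  by have -> : a' g = 0 by apply/eqP; apply: contraNT gE => /a'E.
have /choice[f fP] (s : {ffun E -> bool * bool}) : exists f,
    [/\ `|f| <= 1, forall x, x \in xs -> `|f x| <= e &
      forall a, A a -> (forall g, a g != 0 -> g \in E) -> pattern a = s ->
        forall g, a g != 0 -> c - e <= Num.sg (a g) * u g f].
  have [[a [Aa aE as_]]|noa] := pselect (exists a,
      [/\ A a, forall g, a g != 0 -> g \in E & pattern a = s]).
    have [f [f1 fx fc]] := one_functional xs Aa aE.
    exists f; split=> // a' Aa' a'E a's g.
    have aa' := patternE _ _ aE a'E (etrans as_ (esym a's)) g.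
    by rewrite -sgr_eq0 -aa' sgr_eq0; exact: fc.
  exists 0; split=> [|x _|a Aa aE as_].
  - by rewrite normr0.
  - by rewrite [X in `|X| <= _](_ : _ = 0)// normr0 ltW.
  - by exfalso; apply: noa; exists a.
exists (codom f); split=> [_ /codomP[s ->]|a Aa aE].
  by have [] := fP s.
exists (f (pattern a)); first exact: codom_f.
by have [_ _] := fP (pattern a); apply.
Qed.

(* At each level the functionals are chosen first, nearly vanishing on the    *)
(* points of all smaller levels; the points then imitate u on them.           *)
Lemma approximating_family : exists (fs : level -> seq (dual X)) (x : G * level -> X),
  [/\ forall i f, f \in fs i -> `|f| <= 1,
      forall i a, A a -> (forall g, a g != 0 -> g \in i.1) ->
        exists2 f, f \in fs i & forall g, a g != 0 -> c - e <= Num.sg (a g) * u g f,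
      forall g i, `|x (g, i)| <= 2,
      forall g i j f, level_lt j i -> g \in j.1 -> f \in fs i -> `|f (x (g, j))| <= e &
      forall g i j f, level_le i j -> f \in fs i -> `|f (x (g, j)) - u g f| <= e].
Proof.
(* One step of the recursion settles all levels with the same number. *)
pose T := {fset G} -> seq (dual X) * (G -> X).
pose P n (h : nat -> T) (t : T) := forall E,
  [/\ forall f, f \in (t E).1 -> `|f| <= 1 /\
        forall k E' g, (k < n)%N -> (E' `<=` E)%fset -> g \in E ->
          `|f ((h k E').2 g)| <= e,
      forall a, A a -> (forall g, a g != 0 -> g \in E) ->
        exists2 f, f \in (t E).1 & forall g, a g != 0 -> c - e <= Num.sg (a g) * u g f,
      forall g, `|(t E).2 g| <= 2 &
      forall g f E', (E' `<=` E)%fset -> f \in (t E').1 \/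
          (exists2 k, (k < n)%N & f \in (h k E').1) ->
        `|f ((t E).2 g) - u g f| <= e].
have [|n h|s sP] := @strong_dependent_choice T (fun=> ([::], fun=> 0)) P.
- move=> n h h' t hh' Pt E; have [t1 t2 t3 t4] := Pt E; split=> // [f ft|g f E' E'E].
    have [f1 fx] := t1 _ ft; split=> // k E' g kn.
    by rewrite -hh'//; exact: fx.
  move=> [ft|[k kn fk]]; first by apply: t4 E'E _; left.
  by apply: t4 E'E _; right; exists k; rewrite // hh'.
- pose xs E := [seq p.1 p.2 | p <- [seq (q, g) | q <- [seq (h k E').2 | k <- iota 0 n,
    E' <- enum_fset (fpowerset E)], g <- enum_fset E]].
  have /choice[fs fsP] E := functionals E (xs E).
  (* All functionals with number n are fixed before any point with number n, so these points can
     imitate u on them too. *)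
  pose gs E := flatten [seq fs E' | E' <- enum_fset (fpowerset E)] ++
    flatten [seq (h k E').1 | k <- iota 0 n, E' <- enum_fset (fpowerset E)].
  have two0 : 0 < 2 :> R by [].
  have /choice[x xP] (p : {fset G} * G) := goldstine (gs p.1) two0 (u2 p.2) e0.
  exists (fun E => (fs E, fun g => x (E, g))) => E; have [f1 f2] := fsP E.
  split=> //= [f /f1[? fx]|g|g f E' E'E ff].
  - split=> // k E' g kn E'E gE; apply: fx.
    apply/mapP; exists ((h k E').2, g) => //; apply: allpairs_f => //.
    by apply: allpairs_f; rewrite ?mem_iota//= fpowersetE.
  - by have [] := xP (E, g).
  - have [_] := xP (E, g); apply; rewrite mem_cat; apply/orP.
    case: ff => [ff|[k kn fk]]; [left|right]; apply/flattenP.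
      by exists (fs E') => //; rewrite map_f ?fpowersetE.
    exists (h k E').1 => //.
    by apply: (allpairs_f (fun k E' => (h k E').1)); rewrite ?mem_iota//= fpowersetE.
exists (fun i => (s i.2 i.1).1), (fun p => (s p.2.2 p.2.1).2 p.1).
split=> [[E n] f|[E n] a|g [E n]|g [E n] [E' k] f|g [E n] [E' k] f]; rewrite /level_lt /level_le/=.
- by have [sP1 _ _ _] := sP n E => /sP1[].
- by have [_ sP2 _ _] := sP n E; exact: sP2.
- by have [_ _ sP3 _] := sP n E.
- move=> /andP[E'E kn] gE'; have [sP1 _ _ _] := sP n E => /sP1[_]; apply=> //.
  exact: (fsubsetP E'E).
- move=> /andP[EE']; have [_ _ _ sP4] := sP k E'; rewrite leq_eqVlt => /predU1P[->|nk] fs.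
    by apply: sP4 EE' _; left.
  by apply: sP4 EE' _; right; exists n.
Qed.

End approximating_family.

(** * Lower bound for the index of the patterns *)

Section coclass_index.
Context {R : realType} {G : choiceType} {X : completeNormedModType R}.
Implicit Types (A : set (G -> R)).

(* With h = f0 - (4 / c) f1, where f0 and f1 are functionals of the levels i0 *)
(* and i1 separating a, every term of b has b(p) h(x_p) >= (c / 2) |b(p)|.    *)
Lemma coclass_index_ge A (u : G -> dual (dual X)) (c : R) :
  0 < c <= 1 -> (forall g, `|u g| <= 2) -> A !=set0 ->
  (forall a, A a -> finite_set [set g | a g != 0]) -> A `<=` l1_sphere ->
  (forall a b, A a -> l1_sphere b ->
    (forall g, Num.sg (a g) = Num.sg (b g)) -> A b) ->
  (forall a, A a -> c <= `|l1_op a (fun g =>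
     quotient_map (canonical_subspace X) (u g) : bidual_quotient X)|) ->
  (((c / 2 / (1 + 4 / c)) / 2)%:E <= l1_index X (coclass_patterns A))%E.
Proof.
move=> /andP[c0 c1] u2 [a0 Aa0] Af As Asg Ac.
(* With this choice 4 / c * e = c / 8, and e <= c / 32 since c <= 1. *)
pose e := c ^+ 2 / 32.
have e0 : 0 < e by rewrite divr_gt0 ?exprn_gt0.
have ec : e <= c / 32 by rewrite ler_pM2r ?invr_gt0// expr2 ler_piMr// ltW.
have [|fs [x [f1 fA x2 f_lt f_le]]] := @approximating_family R G X A u c e e0 u2.
  by move=> a Aa; exact: annihilator_functional Ac Aa.
have sep i g j f a : level_le i j -> f \in fs i -> a g != 0 ->
    c - e <= Num.sg (a g) * u g f -> c - e * 2 <= Num.sg (a g) * f (x (g, j)).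
  move=> ij fi ag; have := f_le g _ _ _ ij fi.
  case: (sgrP (a g)) ag => [//|_|_] _; by rewrite ?mul1r ?mulN1r ler_norml; lra.
have c4 : 0 < 4 / c by rewrite divr_gt0.
(* The final division by 2 normalizes x; the factor 1 + 4 / c bounds the norm of h. *)
apply: (l1_index_ge_bounded (y := x)) => //.
- by move=> [g i].
- have [F aF] := finite_support_fset (Af _ Aa0).
  have aF0 g : g \notin F -> a0 g = 0 by rewrite aF negbK => /eqP.
  have [g ag] : exists g, a0 g != 0.
    apply: contrapT => na; have := (l1_sphere_finite aF0).1 (As _ Aa0).
    rewrite big1 => [/esym/eqP|g _]; first by rewrite oner_eq0.
    by apply/eqP; rewrite normr_eq0; apply: contra_notT na => ag; exists g.
  have [|f ff fa] := fA (F, 0%N) _ Aa0; first by move=> h; rewrite aF.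
  exists (g, (F, 0%N)); apply/eqP => xg.
  have := sep _ _ _ _ _ (level_le_refl _) ff ag (fa _ ag).
  by rewrite xg dual0 mulr0; lra.
- by move=> b [].
- by rewrite !divr_ge0 ?addr_ge0 ?ltW.
move=> b [bs bf [a [i0 [i1 [Aa ai0 i01 bP]]]]].
have ai1 g : a g != 0 -> g \in i1.1.
  by move=> /ai0; apply: (fsubsetP (andP i01).1).
have [F bF] := finite_support_fset bf.
have bF0 g : g \notin F -> b g = 0 by rewrite bF negbK => /eqP.
have [h0 h0i h0a] := fA i0 _ Aa ai0; have [h1 h1i h1a] := fA i1 _ Aa ai1.
rewrite (l1_op_finite _ bF0).
have term g : c / 2 * `|b g| <= b g * (h0 (x g) - 4 / c * h1 (x g)).
  case: g => g i; have [->|bg] := eqVneq (b (g, i)) 0; first by rewrite normr0 mul0r mulr0.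
  have ag : a g != 0.
    by apply/eqP => ag; case: (bP _ _ bg) => [[_ [_]]|[_]]; rewrite ag mulr0 ltxx.
  have ke : 4 / c * e = c / 8 by rewrite /e; field; rewrite gt_eqF.
  have kc : 4 / c * c = 4 by rewrite mulfVK// gt_eqF.
  have [i0i H] : level_le i0 i /\ (`|h1 (x (g, i))| <= e /\ 0 < b (g, i) * a g \/
      c - e * 2 <= Num.sg (a g) * h1 (x (g, i)) /\ b (g, i) * a g < 0).
    case: (bP _ _ bg) => [[i0i [ii1 ba]]|[i1i ba]].
      split=> //; left; split=> //; apply: f_lt ii1 _ h1i.
      by apply: (fsubsetP (andP i0i).1); exact: ai0.
    split; first exact: level_le_trans i1i.
    by right; split=> //; exact: sep i1i h1i ag (h1a _ ag).
  have := sep _ _ _ _ _ i0i h0i ag (h0a _ ag).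
  have : `|h0 (x (g, i))| <= 2.
    rewrite (le_trans (dual_norm_ub h0 _))// (le_trans (ler_wpM2r _ (f1 _ _ h0i)))//.
    by rewrite mul1r.
  set r0 := h0 (x (g, i)) in H *; set r1 := h1 (x (g, i)) in H *.
  have bound s : c / 2 <= s * (r0 - 4 / c * r1) ->
      b (g, i) = `|b (g, i)| * s -> c / 2 * `|b (g, i)| <= b (g, i) * (r0 - 4 / c * r1).
    by move=> sr bs'; rewrite [in leRHS]bs' -[leRHS]mulrA [leLHS]mulrC ler_wpM2l.
  have kr (t : R) : t <= e -> 4 / c * t <= c / 8 by rewrite -ke ler_pM2l.
  have kr' (t : R) : c - e * 2 <= t -> 4 - c / 4 <= 4 / c * t.
    by rewrite -(ler_pM2l c4) mulrBr kc mulrA ke; lra.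
  (* Up to sign, below [i1] the term is at least c - 2 e - c / 8; from [i1] on, the second
     functional outweighs the first and leaves at least 4 - c / 4 - 2. *)
  case: (sgrP (a g)) ag H => [//|a0'|a0'] _.
    rewrite pmulr_lgt0// pmulr_llt0// !mul1r => -[[r1e b0]|[r1e b0]] r0e r0c.
      apply: (bound 1); rewrite ?mulr1 ?gtr0_norm// mul1r.
      by have := kr r1; move: r1e; rewrite ler_norml; lra.
    apply: (bound (-1)); rewrite ?mulrN1 ?ltr0_norm ?opprK// mulN1r.
    by have := kr' _ r1e; move: r0e; rewrite ler_norml; lra.
  rewrite nmulr_lgt0// nmulr_llt0// !mulN1r => -[[r1e b0]|[r1e b0]] r0e r0c.
    apply: (bound (-1)); rewrite ?mulrN1 ?ltr0_norm ?opprK// mulN1r.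
    by have := kr (- r1); move: r1e; rewrite ler_norml; lra.
  apply: (bound 1); rewrite ?mulr1 ?gtr0_norm// mul1r.
  by have := kr' _ r1e; move: r0e; rewrite ler_norml; lra.
have b1 := (l1_sphere_finite bF0).1 bs.
have k0 : 0 < 1 + 4 / c by rewrite addr_gt0.
rewrite ler_pdivrMr//.
have -> : c / 2 = \sum_(g <- F) c / 2 * `|b g| by rewrite -mulr_sumr b1 mulr1.
apply: (@le_trans _ _ (\sum_(g <- F) b g * (h0 (x g) - 4 / c * h1 (x g)))).
  by apply: ler_sum => g _; exact: term.
set v := \sum_(g <- F) b g *: x g.
have -> : \sum_(g <- F) b g * (h0 (x g) - 4 / c * h1 (x g)) = h0 v - 4 / c * h1 v.
  rewrite !dual_sum mulr_sumr -sumrB; apply: eq_bigr => g _.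
  by rewrite !dualZ; ring.
have hv (h : dual X) : `|h| <= 1 -> `|h v| <= `|v|.
  move=> hb; rewrite (le_trans (dual_norm_ub h v))//.
  by rewrite (le_trans (ler_wpM2r _ hb))// mul1r.
have := hv _ (f1 _ _ h0i); have := hv _ (f1 _ _ h1i).
rewrite !ler_norml => /andP[v1 v2] /andP[v3 v4].
have : - (4 / c * h1 v) <= 4 / c * `|v| by rewrite -mulrN ler_pM2l//; lra.
by rewrite mulrDr mulr1 [_ * (4 / c)]mulrC; lra.
Qed.

End coclass_index.

(** * Regularity of the coclass *)

Lemma coclass_patterns_sg (R : realType) (G : choiceType) (A : set (G -> R))
    (b0 b : G * ({fset G} * nat) -> R) :
  coclass_patterns A b0 -> l1_sphere b ->
  (forall g, Num.sg (b0 g) = Num.sg (b g)) -> coclass_patterns A b.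
Proof.
move=> [_ bf [a [i0 [i1 [Aa ai i01 bP]]]]] bs bb.
have b0b g : (b0 g != 0) = (b g != 0).
  by rewrite -(sgr_eq0 (b0 g)) bb sgr_eq0.
split=> //.
  by apply: sub_finite_set bf => g /=; rewrite b0b.
exists a, i0, i1; split=> // g i; rewrite -b0b => /bP.
rewrite -(sgr_gt0 (b0 _ * _)) -(sgr_lt0 (b0 _ * _)) sgrM bb -sgrM.
by rewrite sgr_gt0 sgr_lt0.
Qed.

Section regular_l1_property.
Context {R : realType}.
Implicit Types (P : completeNormedModType R -> Prop) (X : completeNormedModType R).

Lemma linf_sphere_neq0 (G : choiceType) X (x : G -> X) :
  linf_sphere x -> exists g, x g != 0.
Proof.
move=> xs; apply: contrapT => nx; have x0 g : `|x g| = 0.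
  by apply/eqP; rewrite normr_eq0; apply: contra_notT nx => xg; exists g.
have [] := xs => _; apply/eqP; rewrite lt_eqF// (@le_lt_trans _ _ 0)//.
have [[g _]|G0] := pselect ([set: G] !=set0).
  by apply: ge_sup => [|_ [h _ <-]]; [exists `|x g|, g|rewrite x0].
rewrite /linf_norm (_ : [set: G] = set0) ?image_set0 ?sup0//.
by rewrite -subset0 => g _; apply: G0; exists g.
Qed.

(* For empty A the index only tells whether X = 0, as does that of a single   *)
(* unit vector.                                                               *)
Lemma regular_l1_property_nonempty P X0 : ~ P X0 -> regular_l1_property P ->
  exists (d : R) (G : choiceType) (A : set (G -> R)), A !=set0 /\
    [/\ 0 < d, A `<=` l1_sphere, forall a, A a -> finite_set [set g | a g != 0],
      forall a0 a, A a0 -> l1_sphere a ->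
        (forall g, Num.sg (a0 g) = Num.sg (a g)) -> A a &
      forall X, (~ P X <-> (0 < l1_index X A)%E) /\
        ((0 < l1_index X A)%E <-> (d%:E <= l1_index X A)%E)].
Proof.
move=> PX0 [d [G [A [d0 As Af Asg AP]]]].
have [A0|A0] := pselect (A !=set0); first by exists d, G, A.
have Gempty a : ~ A a by move=> Aa; apply: A0; exists a.
(* The space [X0] provides a point of G. *)
have /(AP X0).1/l1_index_gt[d1 _ [x0 /linf_sphere_neq0[g0 _] _]] := PX0.
have neq0P X : ~ P X <-> exists z : X, z != 0.
  split=> [/(AP X).1/l1_index_gt[_ _ [x /linf_sphere_neq0[g xg] _]]|[z z0]].
    by exists (x g).
  have z1 : 0 < `|z| by rewrite normr_gt0.
  have [s _ xs] := linf_sphere_normalize z1 (fun=> lexx _)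
    (ex_intro (fun g : G => (fun=> z) g != 0) g0 z0).
  apply/(AP X).1; apply: (@lt_le_trans _ _ 1%:E); first by rewrite lte_fin.
  by apply: (l1_index_ge xs) => a /Gempty.
(* Its one member is the unit vector at [g0], described by signs to make closure under equal signs
   immediate. *)
pose A1 : set (G -> R) := [set a | [/\ l1_sphere a, 0 < a g0 &
  forall g, g != g0 -> a g = 0]].
have A1F a : A1 a -> forall g, g \notin [fset g0]%fset -> a g = 0.
  by move=> [_ _ ag] g; rewrite in_fset1; exact: ag.
have A1f a : A1 a -> finite_set [set g | a g != 0].
  move=> Aa; apply: (sub_finite_set _ (finite_fset [fset g0]%fset)) => g /= ag.
  by apply: contraNT ag => /(A1F _ Aa) ->.
have A1_index X (z : X) : z != 0 -> (1%:E <= l1_index X A1)%E.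
  rewrite -normr_gt0 => z0; rewrite -[1](divff (lt0r_neq0 z0)).
  apply: (l1_index_ge_bounded (y := fun=> z)) => // [|a Aa].
    by exists g0; rewrite -normr_gt0.
  rewrite (l1_op_finite _ (A1F _ Aa)) big_seq_fset1 normrZ.
  have [as1 _ _] := Aa; have := (l1_sphere_finite (A1F _ Aa)).1 as1.
  by rewrite big_seq_fset1 => ->; rewrite mul1r.
exists 1, G, A1; split.
  exists (fun g => (g == g0)%:R); split; first exact: l1_sphere_single.
    by rewrite eqxx.
  by move=> g /negbTE->.
split=> // [a []//|a0 a [_ a0g0 a0g] as1 aa|X].
  split=> // [|g gg0]; first by rewrite -sgr_gt0 -aa sgr_gt0.
  by apply/eqP; rewrite -sgr_eq0 -aa a0g// sgr0.
split.
  rewrite neq0P; split=> [[z /A1_index]|].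
    by apply: lt_le_trans; rewrite lte_fin.
  by move=> /l1_index_gt[_ _ [x /linf_sphere_neq0[g xg] _]]; exists (x g).
split=> [|]; last by apply: lt_le_trans; rewrite lte_fin.
by move=> /l1_index_gt[_ _ [x /linf_sphere_neq0[g xg] _]]; exact: A1_index xg.
Qed.

End regular_l1_property.

Theorem theorem2 (R : realType) (P : completeNormedModType R -> Prop) :
  regular_l1_property P -> regular_l1_property (coclass P).
Proof.
move=> Preg; have [Pall|] := pselect (forall X, P X).
  have [d [G [A [d0 As Af Asg AP]]]] := Preg.
  exists d, G, A; split=> // X; split; last exact: (AP X).2.
  by rewrite -(AP X).1; split; [move=> /(_ (Pall _))|move=> /(_ (Pall _))].
move=> /existsNP[X0 PX0].
have [d [G [A [[a0 Aa0] [d0 As Af Asg AP]]]]] := regular_l1_property_nonempty PX0 Preg.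
(* Strictly below d, because the supremum defining the index need not be attained. *)
pose c : R := Num.min (d / 2) 1.
have c01 : 0 < c <= 1 by rewrite lt_min divr_gt0// ltr01 ge_min lexx orbT.
have cd : c < d by rewrite gt_min; apply/orP; left; lra.
pose d' := c / 2 / (1 + 4 / c) / 2.
have d'0 : 0 < d'.
  by have /andP[c0 _] := c01; rewrite !(divr_gt0, addr_gt0).
have notP_index (X : completeNormedModType R) : ~ coclass P X ->
    (d'%:E <= l1_index X (coclass_patterns A))%E.
  move=> /(AP _).1/(AP _).2 Ad.
  have /l1_index_gt[r cr [y ys yA]] : (c%:E < l1_index (bidual_quotient X) A)%E.
    by apply: lt_le_trans Ad; rewrite lte_fin.
  (* The quotient norm is an infimum; the slack 1 in the lifts gives the bound 2. *)
  have /choice[u uP] g : exists w, quotient_map (canonical_subspace X) w = y g /\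
      `|w| < `|y g| + 1.
    by have [w] := quotient_norm_lift (y g) ltr01; exists w.
  have u2 g : `|u g| <= 2.
    have [_] := uP g.
    by have := linf_sphere_ub g ys; lra.
  apply: (coclass_index_ge (u := u) c01 u2 _ Af As Asg); first by exists a0.
  move=> a Aa; rewrite (_ : (fun g => _) = y) ?(le_trans (ltW cr)) ?yA//.
  by apply/funext => g; have [] := uP g.
exists d', (G * ({fset G} * nat))%type, (coclass_patterns A).
split=> //; [by move=> b []|by move=> b []|exact: coclass_patterns_sg|move=> X].
have index_notP : (0 < l1_index X (coclass_patterns A))%E -> ~ coclass P X.
  move=> /l1_index_gt[r r0 [y ys yA]].
  have [U [UU Utail]] := @level_ultrafilter G.
  have /choice[u uP] g := weak_star_limit UU ler01
    (fun i => linf_sphere_ub (x := y) (g, i) ys).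
  pose q g : bidual_quotient X := quotient_map (canonical_subspace X) (u g).
  have qA := bidual_quotient_ge UU Utail (fun g => (uP g).2) As Af yA.
  apply/(AP _).1; apply: (@lt_le_trans _ _ (r / 1)%:E).
    by rewrite divr1 lte_fin.
  apply: (l1_index_ge_bounded (y := q)) => // [g||].
  - by rewrite (le_trans (quotient_norm_le _ _))//; exact: (uP g).1.
  - apply: contrapT => q0; have := qA _ Aa0; have [F aF] := finite_support_fset (Af _ Aa0).
    have aF0 g : g \notin F -> a0 g = 0 by rewrite aF negbK => /eqP.
    rewrite (l1_op_finite _ aF0) big1 => [|g _]; first by rewrite normr0 leNgt r0.
    have -> : quotient_map (canonical_subspace X) (u g) = 0; last by rewrite scaler0.
    by apply/eqP; apply: contra_notT q0 => qg; exists g.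
  - exact: ltW.
have index_gt0 : (d'%:E <= l1_index X (coclass_patterns A))%E ->
    (0 < l1_index X (coclass_patterns A))%E.
  by apply: lt_le_trans; rewrite lte_fin.
split; first by split=> [/notP_index/index_gt0|/index_notP].
by split=> [/index_notP/notP_index|/index_gt0].
Qed.
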